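(* Let $\Delta\subset\mathbb{R}^r$ be a lattice polytope, $A=\Delta\cap\mathbb{Z}^r$, and let $I\subset\mathbb{C}[A]$ be a homogeneous ideal. Then $\overline{\mathcal{A}}_I=\bigcap_{f}\overline{\mathcal{A}}_f$, where the intersection is over all homogeneous $f\in I$. In particular, $$\overline{\mathcal{A}}_I=\{\alpha\in\Delta\mid \overline{f\{\alpha\}}\text{ is not lopsided for all homogeneous } f\in I\}.$$
   Context: Write $A=\{\mathbf{k}_1,\ldots,\mathbf{k}_d\}$. $\mathbb{C}[A]$ is the graded ring $\mathbb{C}[s^{\mathbf{k}_1},\ldots,s^{\mathbf{k}_d}]/J$, where each generator $s^{\mathbf{k}_i}$ has degree $1$ and $J$ is generated by all relations $s^{\mathbf{k}_{i_1}}\cdots s^{\mathbf{k}_{i_p}}-s^{\mathbf{k}_{j_1}}\cdots s^{\mathbf{k}_{j_p}}$ with $\mathbf{k}_{i_1}+\cdots+\mathbf{k}_{i_p}=\mathbf{k}_{j_1}+\cdots+\mathbf{k}_{j_p}$. The torus $\mathbb{T}=(\mathbb{C}^* )^r$ acts on it by $(\lambda_1,\ldots,\lambda_r)\cdot s^{\mathbf{k}}=\lambda_1^{k_1}\cdots\lambda_r^{k_r}s^{\mathbf{k}}$. Let $X=\mathrm{Proj}(\mathbb{C}[A])$ (a projective toric variety) and $\tilde X=\mathrm{Spec}(\mathbb{C}[A])$. The moment map $\mu:X\to\Delta$ is $$\mu(x)=\frac{\sum_{i=1}^d|s^{\mathbf{k}_i}(x)|^2\,\mathbf{k}_i}{\sum_{i=1}^d|s^{\mathbf{k}_i}(x)|^2},$$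 evaluated on any lift of $x$ to $\tilde X$ (nonzero cone point); $\mu(X)=\Delta$. For a homogeneous ideal $I\subset\mathbb{C}[A]$ with variety $V=\mathrm{Proj}(\mathbb{C}[A]/I)\subset X$, the compactified amoeba is $\overline{\mathcal{A}}_I=\mu(V)\subset\Delta$; for a homogeneous element $f$, $\overline{\mathcal{A}}_f=\overline{\mathcal{A}}_{\langle f\rangle}$. For homogeneous $f\in\mathbb{C}[A]$, write $f=\sum_{i=1}^l m_i$ with the $m_i$ nonzero $\mathbb{T}$-weight vectors of distinct weights. For $\alpha\in\Delta$ choose a point $\tilde\alpha\in\tilde X$ (away from the cone point) mapping to $\alpha$ under $\tilde X\dashrightarrow X\to\Delta$, and let $\overline{f\{\alpha\}}$ be the list $\{|m_1(\tilde\alpha)|,\ldots,|m_l(\tilde\alpha)|\}$ of nonnegative numbers; it is well defined up to rescaling. A list is lopsided if one of its numbers is (strictly) greater than the sum of all the others (an empty sum is $0$; the empty list is not lopsided). *)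

(* Defs.v *)
From HB Require Import structures.
From mathcomp Require Import all_boot all_order all_algebra.
From mathcomp Require Import boolp classical_sets reals.
From mathcomp Require Import ring_quotient complex mpoly.

Set Implicit Arguments.
Unset Strict Implicit.
Unset Printing Implicit Defensive.

Import Order.TTheory GRing.Theory Num.Theory.

Local Open Scope classical_set_scope.
Local Open Scope quotient_scope.
Local Open Scope ring_scope.

Definition lattice_polytope (R : realType) (r : nat) (Delta : set 'rV[R]_r) :=
  exists (n : nat) (v : 'I_n -> 'rV[int]_r),
    Delta = [set a | exists t : 'I_n -> R,
      [/\ forall i, 0 <= t i, \sum_i t i = 1
        & a = \sum_i t i *: map_mx intr (v i)]].

Definition ideal_gen (S : comNzRingType) (G : set S) : set S :=
  [set x | exists (n : nat) (a g : 'I_n -> S),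
    (forall i, G (g i)) /\ x = \sum_i a i * g i].

Section ToricRing.
Variables (R : realType) (r d : nat) (k : 'I_d -> 'rV[int]_r).

Local Notation C := R[i].
Local Notation P := {mpoly C[d]}.

Definition toric_relation : set P :=
  [set q | exists (p : nat) (i j : 'I_p -> 'I_d),
    \sum_a k (i a) = \sum_a k (j a) /\
    q = \prod_a 'X_(i a) - \prod_a 'X_(j a)].

(* The ideal J, as a Boolean predicate: library quotients require one. *)
Definition toric_ideal : {pred P} := [pred q | `[< ideal_gen toric_relation q >]].

Lemma toric_ideal_idealr_closed : idealr_closed toric_ideal.
Proof.
split.
- by apply/asboolP; exists 0%N, (fun=> 0), (fun=> 0); split=> [[]//|]; rewrite big_ord0.
- apply/negP => /asboolP [n [a [g [gG]]]].
  move/(congr1 (meval (fun=> 1))); rewrite meval1 raddf_sum big1 => [/eqP|i _].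
    by rewrite oner_eq0.
  rewrite /= mevalM; have [p [s [t [_ ->]]]] := gG i.
  by rewrite mevalB !rmorph_prod /= !big1 ?subrr ?mulr0 // => j _; rewrite mevalXU.
- move=> a x y /asboolP [n [b [g [gG ->]]]] /asboolP [n' [b' [g' [gG' ->]]]].
  apply/asboolP; exists (n + n')%N.
  exists (fun i => match split i with inl j => a * b j | inr j => b' j end).
  exists (fun i => match split i with inl j => g j | inr j => g' j end).
  split=> [i|]; first by case: split.
  rewrite big_split_ord mulr_sumr; congr (_ + _); apply: eq_bigr => i _.
    by rewrite (unsplitK (inl i)) mulrA.
  by rewrite (unsplitK (inr i)).
Qed.

HB.instance Definition _ := isIdealr.Build P toric_ideal toric_ideal_idealr_closed.

(* The ring C[A], for A the range of k. *)
Definition toric_ring := {ideal_quot toric_ideal}.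

HB.instance Definition _ := GRing.ComNzRing.on toric_ring.
HB.instance Definition _ :=
  NzRingQuotient.on toric_ring.

Definition homogeneous : set toric_ring :=
  [set f | exists (p : nat) (q : P), q \is p.-homog /\ f = \pi_toric_ring q].

Definition homogeneous_ideal (I : set toric_ring) :=
  exists2 G : set toric_ring, G `<=` homogeneous & I = ideal_gen G.

(* Closed points of Spec C[A], embedded in C^d by x |-> (s^{k_i}(x))_i. *)
Definition spec : set 'rV[C]_d :=
  [set x | forall q : P, q \in toric_ideal -> q.@[x 0] = 0].

(* The value at a point x of spec; it does not depend on the representative. *)
Definition toric_eval (x : 'rV[C]_d) (f : toric_ring) : C := (repr f).@[x 0].

(* Closed points of Proj (C[A]/I), given by all their lifts to the cone. *)
Definition proj_lifts (I : set toric_ring) : set 'rV[C]_d :=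
  [set x | [/\ spec x, x != 0 & forall f, I f -> toric_eval x f = 0]].

Definition moment_map (x : 'rV[C]_d) : 'rV[R]_r :=
  (\sum_i Normc.normc (x 0 i) ^+ 2)^-1 *:
    \sum_i Normc.normc (x 0 i) ^+ 2 *: map_mx intr (k i).

Definition amoeba (I : set toric_ring) : set 'rV[R]_r :=
  moment_map @` proj_lifts I.

Definition lift_of (alpha : 'rV[R]_r) : set 'rV[C]_d :=
  [set x | [/\ spec x, x != 0 & moment_map x = alpha]].

Definition torus_char (w : 'rV[int]_r) (lambda : 'I_r -> C) : C :=
  \prod_j lambda j ^ w 0 j.

Definition torus_act (lambda : 'I_r -> C) (f : toric_ring) : toric_ring :=
  \pi_toric_ring
    (repr f \mPo [tuple torus_char (k i) lambda *: 'X_i | i < d]).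

Definition weight_vector (w : 'rV[int]_r) (m : toric_ring) :=
  forall lambda : 'I_r -> C, (forall j, lambda j != 0) ->
    torus_act lambda m = \pi_toric_ring (torus_char w lambda)%:MP * m.

Definition weight_decomposition
    (f : toric_ring) (l : nat) (m : 'I_l -> toric_ring) :=
  f = \sum_i m i /\
  exists w : 'I_l -> 'rV[int]_r,
    injective w /\ forall i, m i != 0 /\ weight_vector (w i) (m i).

(* s is the list of the |m_i(x)|; the weight decomposition of f, hence s, is
   unique up to the order of the terms. *)
Definition abs_values (f : toric_ring) (x : 'rV[C]_d) (s : seq R) :=
  exists (l : nat) (m : 'I_l -> toric_ring),
    weight_decomposition f m /\
    s = [seq Normc.normc (toric_eval x (m i)) | i <- enum 'I_l].

End ToricRing.

Definition lopsided (R : realType) (s : seq R) :=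
  exists i : 'I_(size s), \sum_(j < size s | j != i) s`_j < s`_i.

(* Main.v *)
(* Write mu(x) = alpha.  By Birch's theorem the moduli of the coordinates of a
   lift of alpha are determined up to scaling (two solutions of the binomial
   relations with the same barycentre would contradict each other on an integral
   relation with the sign pattern of their difference), and they exist for every
   alpha in Delta (maximise the entropy).  Since a weight component of a
   homogeneous f is a scalar times a monomial on the cone, the list f{alpha} only
   depends on these moduli, and a lopsided list excludes a zero of f over alpha.

   Conversely, suppose that I has no common zero on the fibre |x_i| = |y_i| of a
   lift y.  By compactness finitely many generators f_j satisfy
   G = sum_j |f_j|^2 >= delta > 0 on the fibre.  There the conjugate of f_j is,
   up to a monomial x^e that does not vanish, a polynomial g_j, so that
   F = sum_j f_j g_j lies in I and equals G x^e on the fibre.  If M bounds G,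
   then E = (x^e - F/M)^n has modulus at most |y^e|^n (1 - delta/M)^n on the
   fibre, hence so do its weight components (average over roots of unity), whose
   number grows polynomially in n.  For large n the element x^(ne) - E of I is
   lopsided at y. *)
Require Import Defs.
From mathcomp Require Import all_boot all_order all_algebra.
From mathcomp Require Import boolp classical_sets reals.
From mathcomp Require Import complex.
From mathcomp Require Import cyclic separable cyclotomic.
From mathcomp Require Import ring lra zify.

Set Implicit Arguments.
Unset Strict Implicit.
Unset Printing Implicit Defensive.

Import Order.TTheory GRing.Theory Num.Theory.

Local Open Scope classical_set_scope.
Local Open Scope ring_scope.

Module Analytic.
From mathcomp Require Import all_classical topology normedtype derive realfun exp.
Import numFieldNormedType.Exports.

(** * Compactness and continuity for real row vectors *)

Section Compactness.
Variables (R : realType) (n : nat).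

Lemma closed_coord_bounded_compact (A : set 'rV[R]_n) (B : R) :
  closed A -> (forall v, A v -> forall i, `|v 0 i| <= B) -> compact A.
Proof.
move=> clA bdA; apply: bounded_closed_compact clA.
exists (Num.max B 0); split; first exact: num_real.
move=> M BM v /bdA vB /=; rewrite [leLHS]/Num.norm /= mx_normrE.
apply/bigmax_leP; split=> [|[i j] _ /=].
  by rewrite ltW // (le_lt_trans _ BM) // le_max lexx orbT.
by rewrite ord1 (le_trans (vB j)) // ltW // (le_lt_trans _ BM) // le_max lexx.
Qed.

Lemma continuous_sumr (T : topologicalType) (I : Type) (s : seq I) (f : I -> T -> R) :
  (forall i, continuous (f i)) -> continuous (fun x => \sum_(i <- s) f i x).
Proof.
move=> cf; elim: s => [|i s IHs] x.
  under [fun _ => _]eq_fun do rewrite big_nil.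
  exact: cst_continuous.
under [fun _ => _]eq_fun do rewrite big_cons.
by apply: continuousD; [exact: cf | exact: IHs].
Qed.

Lemma continuousMDM (T : topologicalType) (f g f' g' : T -> R) :
  continuous f -> continuous g -> continuous f' -> continuous g' ->
  continuous (fun x => f x * g x + f' x * g' x).
Proof.
move=> cf cg cf' cg' x.
apply: (continuousD (f := fun x => f x * g x) (g := fun x => f' x * g' x)).
  by apply: continuousM; [exact: cf | exact: cg].
by apply: continuousM; [exact: cf' | exact: cg'].
Qed.

Lemma closed_level (T : topologicalType) (f : T -> R) (c : R) :
  continuous f -> closed [set x | f x = c].
Proof.
move=> cf; apply: (closed_comp (f := f) (D := [set y | y = c])) => [x _|//].
exact: cf.
Qed.

End Compactness.

(** * Entropy and the existence part of Birch's theorem *)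

Section Entropy.
Variable R : realType.


(** Put s = sqrt x. Then x ln x = 2 s (s ln s), and -ln s = ln (1/s) <= 1/s bounds the bracket by 1
    in modulus. This yields the continuity of x ln x at 0. *)
Lemma xlnx_bound (x : R) : 0 < x -> x <= 1 -> `|x * ln x| <= 2 * Num.sqrt x.
Proof.
move=> x0 x1; have s0 : 0 < Num.sqrt x by rewrite sqrtr_gt0.
have xE : x = Num.sqrt x ^+ 2 by rewrite sqr_sqrtr // ltW.
have lnV' : - ln (Num.sqrt x) <= (Num.sqrt x)^-1.
  by rewrite -lnV ?posrE // ltW // ln_sublinear // invr_gt0.
have l0 : ln (Num.sqrt x) <= 0 by rewrite ln_le0 // -sqrtr1 ler_sqrt.
rewrite {1 2}xE lnXn // normrM ger0_norm ?sqr_ge0 // normrMn ler0_norm //.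
rewrite mulrnAr -mulr_natl ler_pM2l // expr2 -mulrA -[leRHS]mulr1 ler_pM2l //.
by apply: le_trans (ler_wpM2l (ltW s0) lnV') _; rewrite mulfV ?gt_eqF.
Qed.

Lemma continuous_xlnx : continuous (fun x : R => x * ln x).
Proof.
move=> x; have [x0|x0|<-] := ltgtP 0 x.
- by apply: continuousM; [exact: cvg_id | exact: continuous_ln].
- apply: (near_cst_continuous 0); near=> y; rewrite ln0 ?mulr0 //.
  by rewrite ltW //; near: y; exact: lt_nbhsl.
- rewrite /continuous_at mul0r; apply/cvgr0Pnorm_lt => e e0.
  have s0 : Num.sqrt y @[y --> (0 : R)] --> (0 : R).
    by rewrite -[X in _ --> X]sqrtr0; exact: sqrt_continuous.
  near=> y; have [y0|y0] := leP y 0; first by rewrite ln0 // mulr0 normr0.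
  have y1 : y <= 1 by rewrite ltW //; near: y; apply: lt_nbhsl.
  apply: le_lt_trans (xlnx_bound y0 y1) _.
  rewrite mulrC -ltr_pdivlMr //; near: y.
  by apply: (cvgr_lt _ s0); rewrite divr_gt0.
Unshelve. all: by end_near. Qed.

(* [ln] is 0 at 0, which gives the usual convention 0 ln 0 = 0. *)
Lemma gibbs (n : nat) (p q : 'I_n -> R) :
  (forall i, 0 <= p i) -> (forall i, 0 <= q i) -> \sum_i p i = \sum_i q i ->
  (forall i, 0 < p i -> 0 < q i) ->
  \sum_i p i * ln (q i) <= \sum_i p i * ln (p i).
Proof.
move=> p0 q0 pq spq; rewrite -subr_ge0 -sumrB.
(* Termwise comparison with p_i - q_i, whose sum is 0; where p_i > 0 it amounts to ln (q_i/p_i) <=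
   q_i/p_i - 1. *)
rewrite -[leLHS](_ : \sum_i (p i - q i) = 0); last by rewrite sumrB pq subrr.
apply: ler_sum => i _; have [pi0|pi_le0] := ltP 0 (p i); last first.
  have -> : p i = 0 by apply/eqP; rewrite eq_le p0 pi_le0.
  by rewrite !mul0r subrr sub0r oppr_le0.
have qi0 := spq _ pi0; rewrite -mulrBr -lerN2 -mulrN !opprB -ln_div ?posrE //.
have -> : q i / p i = 1 + (q i / p i - 1) by ring.
rewrite -ler_pdivlMl //; apply: le_trans (le_ln1Dx _) _.
  by rewrite ltrBrDl subrr divr_gt0.
by rewrite mulrBr mulVf ?gt_eqF // mulrC.
Qed.

Lemma ln_prodX (n : nat) (q : 'I_n -> R) (a : 'I_n -> nat) :
  (forall i, (0 < a i)%N -> 0 < q i) ->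
  0 < \prod_i q i ^+ a i /\
  ln (\prod_i q i ^+ a i) = \sum_i (a i)%:R * ln (q i).
Proof.
move=> qa.
have f0 i : 0 < q i ^+ a i.
  by case: (a i) (qa i) => [_|m /(_ isT) qi0]; rewrite ?expr0 // exprn_gt0.
elim/big_ind2: _ => [|x1 x2 y1 y2 [x0 <-] [y0 <-]|i _].
- by rewrite ltr01 ln1.
- by rewrite mulr_gt0 // lnM ?posrE.
split=> //; case: (a i) (qa i) => [_|m /(_ isT) qi0].
  by rewrite expr0 ln1 mul0r.
by rewrite lnXn // mulr_natl.
Qed.

(* Birch's theorem: [p] is the distribution of maximal entropy with the same
   barycentre as [t]. *)
Lemma birch (d r : nat) (k : 'I_d -> 'rV[R]_r) (t : 'I_d -> R) :
  (forall i, 0 <= t i) -> \sum_i t i = 1 ->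
  exists p : 'I_d -> R,
    [/\ forall i, 0 <= p i, \sum_i p i = 1,
        \sum_i p i *: k i = \sum_i t i *: k i
      & forall a b : 'I_d -> nat,
          (\sum_i a i = \sum_i b i)%N ->
          \sum_i k i *+ a i = \sum_i k i *+ b i ->
          \prod_i p i ^+ a i = \prod_i p i ^+ b i].
Proof.
move=> t0 t1; set alpha := \sum_i t i *: k i.
pose A := [set p : 'rV[R]_d | [/\ forall i, 0 <= p 0 i, \sum_i p 0 i = 1
  & \sum_i p 0 i *: k i = alpha]].
have Ale1 p i : A p -> p 0 i <= 1.
  by case=> p0 <- _; rewrite (bigD1 i) //= lerDl sumr_ge0.
have clA : closed A.
  have -> : A = (\bigcap_i [set p | 0 <= p 0 i]) `&` [set p | \sum_i p 0 i = 1]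
      `&` (\bigcap_j [set p | \sum_i p 0 i * k i 0 j = alpha 0 j]).
    apply/seteqP; split=> p /= => [[p0 p1 pk]|[[p0 p1] pk]].
      split; [by split=> // i _; exact: p0|move=> j _ /=].
      rewrite -pk summxE; apply: eq_bigr => i _; by rewrite mxE.
    split=> // [i|]; first exact: p0.
    apply/rowP => j; rewrite -(pk j) // summxE.
    by apply: eq_bigr => i _; rewrite mxE.
  apply: closedI; first apply: closedI.
  - apply: closed_bigI => i _.
    apply: (closed_comp (f := fun p : 'rV[R]_d => p 0 i)
      (D := [set y | 0 <= y])) => [p _|]; last exact: closed_ge.
    exact: coord_continuous.
  - apply: closed_level; apply: continuous_sumr => i; exact: coord_continuous.
  - apply: closed_bigI => j _; apply: closed_level; apply: continuous_sumr => i p.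
    by apply: continuousM; [exact: coord_continuous | exact: cst_continuous].
have cA : compact A.
  apply: (closed_coord_bounded_compact (B := 1) clA) => p Ap i.
  by rewrite ger0_norm ?Ale1 //; case: Ap.
have A0 : A !=set0.
  exists (\row_i t i); split=> [i||]; first by rewrite mxE.
    by rewrite -t1; apply: eq_bigr => i _; rewrite mxE.
  by apply: eq_bigr => i _; rewrite mxE.
have cF : continuous (fun p : 'rV[R]_d => \sum_i p 0 i * ln (p 0 i)).
  apply: continuous_sumr => i p.
  apply: (continuous_comp (f := fun p : 'rV[R]_d => p 0 i)
    (g := fun x : R => x * ln x)); first exact: coord_continuous.
  exact: continuous_xlnx.
have [p /set_mem Ap pmin] := EVT_min_rV A0 cA (continuous_subspaceT cF).
have [p0 p1 pk] := Ap.
exists (p 0); split=> // a b ab kab.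
(* By symmetry in a and b one implication suffices: if one product is positive both inequalities
   follow, otherwise both products are 0. *)
wlog suff : a b ab kab / 0 < \prod_i p 0 i ^+ b i ->
    \prod_i p 0 i ^+ b i <= \prod_i p 0 i ^+ a i.
  move=> le_ba; have le_ab := le_ba b a (esym ab) (esym kab).
  have {}le_ba := le_ba a b ab kab.
  have prod0 c : 0 <= \prod_i p 0 i ^+ c i.
    by apply: prodr_ge0 => i _; rewrite exprn_ge0.
  have := prod0 a; have := prod0 b; rewrite !le_eqVlt => /orP[/eqP b0|b0].
    case/orP=> [/eqP a0|a0]; first by rewrite -a0.
    by move: (le_ab a0); rewrite -b0 leNgt a0.
  move=> _; apply/eqP; rewrite eq_le le_ba // andbT le_ab //.
  exact: lt_le_trans (le_ba b0).
move=> b0; rewrite leNgt; apply/negP => ltab.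
have bp i : (0 < b i)%N -> 0 < p 0 i.
  move=> bi0; rewrite lt_neqAle p0 andbT eq_sym; apply/eqP => pi0.
  by move: b0; rewrite (bigD1 i) //= pi0 expr0n (gtn_eqF bi0) mul0r ltxx.
(* The direction u has total 0 and moment 0, so p + e u stays in A for small e > 0: where p_i = 0
   also b_i = 0, hence u_i >= 0. The strict inequality between the two products persists for small
   e, because they are polynomials in e. *)
pose u i : R := (a i)%:R - (b i)%:R.
pose q e i := p 0 i + e * u i.
pose P (c : 'I_d -> nat) : {poly R} := \prod_i ((p 0 i)%:P + (u i) *: 'X) ^+ c i.
have PE c e : (P c).[e] = \prod_i q e i ^+ c i.
  rewrite horner_prod; apply: eq_bigr => i _.
  by rewrite horner_exp !hornerE /q [u i * e]mulrC.
have [e []] : exists e, [/\ 0 < e, forall i, 0 < p 0 i -> 0 < q e i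
    & (P a).[e] < (P b).[e]].
  near ((0 : R)^'+) => e; exists e; split.
  - near: e; exact: nbhs_right_gt.
  - near: e; apply: filter_forall => i.
    have [pi0|pi0] := ltP 0 (p 0 i); last by near=> e.
    have : (fun e => q e i) e @[e --> (0 : R)^'+] --> p 0 i.
      apply: cvg_at_right_filter; rewrite -[X in _ --> X]addr0.
      apply: cvgD; first exact: cvg_cst.
      rewrite -[X in _ --> X](mul0r (u i)).
      by apply: cvgM; [exact: cvg_id | exact: cvg_cst].
    by move=> cq; near=> e => _; near: e; exact: (cvgr_gt _ cq).
  - rewrite -subr_gt0 -hornerN -hornerD; near: e.
    have : (fun e => (P b - P a).[e]) e @[e --> (0 : R)^'+] --> (P b - P a).[0].
      by apply: cvg_at_right_filter; exact: continuous_horner.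
    move=> /cvgr_gt; apply; rewrite hornerD hornerN subr_gt0 !PE /q.
    under eq_bigr do rewrite mul0r addr0.
    by under [ltRHS]eq_bigr do rewrite mul0r addr0.
move=> e0 pq; rewrite !PE; apply/negP; rewrite -leNgt.
have q0 i : 0 <= q e i.
  have [/pq/ltW//|pi0] := ltP 0 (p 0 i).
  have pi0' : p 0 i = 0 by apply/eqP; rewrite eq_le p0 pi0.
  have bi0 : b i = 0%N by case: (b i) (bp i) => // m /(_ isT); rewrite pi0' ltxx.
  by rewrite /q /u pi0' bi0 subr0 add0r mulr_ge0 // ltW.
have qb i : (0 < b i)%N -> 0 < q e i by move=> /bp/pq.
have qa i : (0 < a i)%N -> 0 < q e i.
  move=> ai0; case: (posnP (b i)) => [bi0|/qb//].
  by rewrite /q /u bi0 subr0 ltr_wpDl // mulr_gt0 // ltr0n.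
have su : \sum_i u i = 0.
  by rewrite sumrB -!natr_sum ab subrr.
have suk : \sum_i u i *: k i = 0.
  under eq_bigr do rewrite scalerBl !scaler_nat.
  by rewrite sumrB kab subrr.
have Aq : A (\row_i q e i).
  split=> [i||]; first by rewrite mxE.
    under eq_bigr do rewrite mxE.
    by rewrite big_split /= -mulr_sumr su mulr0 addr0.
  under eq_bigr do rewrite mxE scalerDl -scalerA.
  by rewrite big_split /= -scaler_sumr suk scaler0 addr0.
have := pmin _ (mem_set Aq).
under [in X in _ <= X]eq_bigr do rewrite mxE.
have spq : \sum_i p 0 i = \sum_i q e i.
  by rewrite /q big_split /= -mulr_sumr su mulr0 addr0.
(* Gibbs and the minimality of p give sum p ln q <= sum p ln p <= sum q ln q. The outer difference
   is e times ln q^a - ln q^b, which is therefore nonnegative. *)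
move/(le_trans (gibbs p0 q0 spq pq)).
have -> : \sum_i q e i * ln (q e i) = \sum_i p 0 i * ln (q e i) +
   e * (\sum_i (a i)%:R * ln (q e i) - \sum_i (b i)%:R * ln (q e i)).
  rewrite -sumrB mulr_sumr -big_split; apply: eq_bigr => i _ /=.
  by rewrite -mulrBl mulrA -mulrDl.
rewrite lerDl pmulr_rge0 // subr_ge0.
have [pa <-] := ln_prodX qa; have [pb <-] := ln_prodX qb.
by rewrite ler_ln ?posrE.
Unshelve. all: by end_near. Qed.

End Entropy.

(** * Compact fibres of the coordinatewise modulus *)

Section ComplexFiber.
Variables (R : realType) (n : nat).
Local Notation C := R[i].

Definition complexify (v : 'rV[R]_(n + n)) : 'rV[C]_n :=
  \row_i (v 0 (lshift n i) +i* v 0 (rshift n i))%C.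

Lemma complexify_surj (x : 'rV[C]_n) : exists v, complexify v = x.
Proof.
exists (row_mx (\row_i complex.Re (x 0 i)) (\row_i complex.Im (x 0 i))).
by apply/rowP => i; rewrite mxE row_mxEl row_mxEr !mxE; case: (x 0 i).
Qed.

(* [R[i]] carries no topology that is related to the one of [R], so continuity
   is expressed on real coordinates. *)
Definition ccontinuous (f : 'rV[C]_n -> C) :=
  continuous (fun v => complex.Re (f (complexify v))) /\
  continuous (fun v => complex.Im (f (complexify v))).

Lemma ccontinuous_cst (c : C) : ccontinuous (fun=> c).
Proof. by split=> v; exact: cst_continuous. Qed.

Lemma ccontinuous_coord (i : 'I_n) : ccontinuous (fun x => x 0 i).
Proof.
split; under [fun _ => _]eq_fun do rewrite mxE /=; exact: coord_continuous.
Qed.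

Lemma ccontinuousD f g : ccontinuous f -> ccontinuous g ->
  ccontinuous (fun x => f x + g x).
Proof.
move=> [fr fi] [gr gi]; split.
  have -> : (fun v => complex.Re (f (complexify v) + g (complexify v))) =
    (fun v => complex.Re (f (complexify v)) + complex.Re (g (complexify v))).
    by apply/funext => v; case: (f _) (g _) => [? ?] [].
  by move=> v; apply: continuousD; [exact: fr | exact: gr].
have -> : (fun v => complex.Im (f (complexify v) + g (complexify v))) =
  (fun v => complex.Im (f (complexify v)) + complex.Im (g (complexify v))).
  by apply/funext => v; case: (f _) (g _) => [? ?] [].
by move=> v; apply: continuousD; [exact: fi | exact: gi].
Qed.

Lemma ccontinuousM f g : ccontinuous f -> ccontinuous g ->
  ccontinuous (fun x => f x * g x).
Proof.
move=> [fr fi] [gr gi]; split.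
  have -> : (fun v => complex.Re (f (complexify v) * g (complexify v))) =
    (fun v => complex.Re (f (complexify v)) * complex.Re (g (complexify v))
            - complex.Im (f (complexify v)) * complex.Im (g (complexify v))).
    by apply/funext => v; case: (f _) (g _) => [? ?] [].
  move=> v; apply: (continuousB
    (f := fun v => complex.Re (f (complexify v)) * complex.Re (g (complexify v)))
    (g := fun v => complex.Im (f (complexify v)) * complex.Im (g (complexify v)))).
    by apply: continuousM; [exact: fr | exact: gr].
  by apply: continuousM; [exact: fi | exact: gi].
have -> : (fun v => complex.Im (f (complexify v) * g (complexify v))) =
  (fun v => complex.Re (f (complexify v)) * complex.Im (g (complexify v))
          + complex.Im (f (complexify v)) * complex.Re (g (complexify v))).
  by apply/funext => v; case: (f _) (g _) => [? ?] [].
by apply: continuousMDM.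
Qed.

Lemma ccontinuous_sum (I : Type) (s : seq I) (f : I -> 'rV[C]_n -> C) :
  (forall i, ccontinuous (f i)) -> ccontinuous (fun x => \sum_(i <- s) f i x).
Proof.
move=> cf; elim: s => [|i s IHs].
  by under [fun _ => _]eq_fun do rewrite big_nil; exact: ccontinuous_cst.
under [fun _ => _]eq_fun do rewrite big_cons.
by apply: ccontinuousD; [exact: cf | exact: IHs].
Qed.

Lemma ccontinuous_prod (I : Type) (s : seq I) (f : I -> 'rV[C]_n -> C) :
  (forall i, ccontinuous (f i)) -> ccontinuous (fun x => \prod_(i <- s) f i x).
Proof.
move=> cf; elim: s => [|i s IHs].
  by under [fun _ => _]eq_fun do rewrite big_nil; exact: ccontinuous_cst.
under [fun _ => _]eq_fun do rewrite big_cons.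
by apply: ccontinuousM; [exact: cf | exact: IHs].
Qed.

Lemma ccontinuousX (f : 'rV[C]_n -> C) (m : nat) :
  ccontinuous f -> ccontinuous (fun x => f x ^+ m).
Proof.
move=> cf; elim: m => [|m IHm].
  by under [fun _ => _]eq_fun do rewrite expr0; exact: ccontinuous_cst.
by under [fun _ => _]eq_fun do rewrite exprS; exact: ccontinuousM.
Qed.

Lemma continuous_normc2 f : ccontinuous f ->
  continuous (fun v => Normc.normc (f (complexify v)) ^+ 2).
Proof.
move=> [fr fi]; have -> : (fun v => Normc.normc (f (complexify v)) ^+ 2) =
    (fun v => complex.Re (f (complexify v)) * complex.Re (f (complexify v)) +
      complex.Im (f (complexify v)) * complex.Im (f (complexify v))).
  apply/funext => v; case: (f _) => a b /=.
  by rewrite sqr_sqrtr ?addr_ge0 ?sqr_ge0.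
by apply: continuousMDM.
Qed.

(** The fibre K is closed and bounded, hence compact, and the open sets |h_j|^2 > 1/(m+1) with j in
    D cover it. A finite subcover gives the list s, and its thresholds give delta. *)
Lemma polytorus_sum_sqr_lower_bound (T : Type) (c : T -> 'rV[C]_n -> C)
    (rho : 'I_n -> R) (J : choiceType) (D : set J) (h : J -> 'rV[C]_n -> C) :
  let K := [set x | (forall t, c t x = 0) /\
                    forall i, Normc.normc (x 0 i) = rho i] in
  (forall t, ccontinuous (c t)) -> (forall j, ccontinuous (h j)) ->
  (forall x, K x -> exists2 j, D j & h j x != 0) ->
  exists (s : seq J) (delta : R), [/\ 0 < delta, forall j, j \in s -> D j
    & forall x, K x -> delta <= \sum_(j <- s) Normc.normc (h j x) ^+ 2].
Proof.
move=> K cc ch Kh.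
pose A := [set v | K (complexify v)].
have normc0 (z : C) : 0 <= Normc.normc z by case: z => a b; exact: sqrtr_ge0.
have clA : closed A.
  (* The continuous functions at hand are the squared moduli. They encode the modulus condition once
     rho >= 0, which is imposed as a separate term; K is empty when it fails. *)
  have -> : A = (\bigcap_t [set v | Normc.normc (c t (complexify v)) ^+ 2 = 0])
      `&` (\bigcap_i [set v |
             Normc.normc ((complexify v) 0 i) ^+ 2 = Num.max 0 (rho i) ^+ 2])
      `&` [set v | forall i, 0 <= rho i].
    apply/seteqP; split=> v /= [].
      move=> v0 vrho; split; first split=> [t _|i _] /=.
      - by rewrite v0 Normc.normc0 expr0n.
      - by rewrite vrho max_r // -(vrho i).
      - by move=> i; rewrite -(vrho i).
    move=> [v0 vrho] rho0; split=> [t|i].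
      apply: Normc.eq0_normc; apply/eqP; rewrite -sqrf_eq0; exact/eqP/v0.
    by have /eqP := vrho i I; rewrite max_r // eqrXn2 // => /eqP.
  apply: closedI; first apply: closedI.
  - by apply: closed_bigI => t _; exact: closed_level (continuous_normc2 (cc t)).
  - apply: closed_bigI => i _.
    exact: closed_level (continuous_normc2 (ccontinuous_coord i)).
  - have [rho0|rho0] := pselect (forall i, 0 <= rho i).
      rewrite (_ : [set v | _] = setT); first exact: closedT.
      by apply/seteqP; split.
    rewrite (_ : [set v | _] = set0); first exact: closed0.
    by apply/seteqP; split.
have cA : compact A.
  apply: (closed_coord_bounded_compact (B := \sum_i `|rho i|) clA) => v [_ vr] i.
  suff [j vj] : exists j, `|v 0 i| <= rho j.
    apply: le_trans vj _; apply: le_trans (ler_norm _) _.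
    by rewrite (bigD1 j) //= lerDl sumr_ge0.
  case: (splitP i) => j ij; exists j; rewrite -vr mxE /=.
    have -> : i = lshift n j by apply/val_inj.
    rewrite -sqrtr_sqr ler_sqrt ?addr_ge0 ?sqr_ge0 // lerDl; exact: sqr_ge0.
  have -> : i = rshift n j by apply/val_inj.
  rewrite -sqrtr_sqr ler_sqrt ?addr_ge0 ?sqr_ge0 // lerDr; exact: sqr_ge0.
pose U (jm : J * nat) :=
  [set v | jm.2.+1%:R^-1 < Normc.normc (h jm.1 (complexify v)) ^+ 2].
move: cA; rewrite compact_cover.
move=> /(_ (J * nat)%type [set jm | D jm.1] U) [].
- move=> jm _.
  apply: (open_comp (f := fun v => Normc.normc (h jm.1 (complexify v)) ^+ 2)
    (D := [set y | jm.2.+1%:R^-1 < y])) => [v _|]; last exact: open_gt.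
  exact: continuous_normc2.
- move=> v /Kh [j Dj hj]; set y := Normc.normc (h j (complexify v)) ^+ 2.
  have y0 : 0 < y.
    rewrite exprn_gt0 // lt_neqAle normc0 andbT eq_sym.
    by apply: contraNneq hj => /Normc.eq0_normc ->.
  exists (j, Num.truncn y^-1) => //=; rewrite /U /= -/y.
  rewrite invf_plt ?posrE //; exact: truncnS_gt.
move=> F FD AF.
(* M + 1 exceeds every m + 1 of the subcover, so its inverse lies below every threshold; the
   successor keeps it positive for an empty subcover. *)
pose M := (\sum_(jm <- finmap.enum_fset F) jm.2.+1)%N.
exists [seq jm.1 | jm <- finmap.enum_fset F], (M.+1%:R^-1); split.
- by rewrite invr_gt0 ltr0n.
- by move=> j /mapP [jm /FD jmD ->]; exact: set_mem jmD.
move=> x; have [v <-] := complexify_surj x => /AF [jm /= jmF] /ltW jmv.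
rewrite big_map (big_rem jm) //=; apply: ler_wpDr.
  by apply: sumr_ge0 => j _; exact: sqr_ge0.
apply: le_trans jmv; rewrite lef_pV2 ?posrE ?ltr0n // ler_nat.
by rewrite /M (big_rem jm) //= ltnW // ltnS leq_addr.
Qed.

End ComplexFiber.

End Analytic.

(** * Integral relations and the uniqueness part of Birch's theorem *)

Section IntegerKernel.
Variable R : realType.

(** The kernel is spanned by rational vectors, the rows of N, so u is a real combination of them
    with coefficients w; rational coefficients near w give v. Closeness keeps the nonzero signs, and
    the zeros of u are imposed as extra equations by the diagonal block of [M1]. *)
Lemma rat_kernel_sign (d m : nat) (M : 'M[rat]_(d, m)) (u : 'rV[R]_d) :
  u *m map_mx ratr M = 0 ->
  exists2 v : 'rV[rat]_d, v *m M = 0 & 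
    forall i, (0 < v 0 i) = (0 < u 0 i) /\ (v 0 i < 0) = (u 0 i < 0).
Proof.
move=> uM.
pose M1 := row_mx M (diag_mx (\row_i (u 0 i == 0)%:R : 'rV[rat]_d)).
have uM1 : u *m map_mx ratr M1 = 0.
  rewrite map_row_mx mul_mx_row uM map_diag_mx mul_mx_diag.
  apply/rowP => j; rewrite !mxE; case: splitP => j' _; rewrite !mxE //.
  by have [->|] := eqVneq (u 0 j') 0; rewrite ?mul0r // rmorph0 mulr0.
have : (u <= kermx (map_mx ratr M1))%MS by apply/sub_kermxP.
rewrite -map_kermx => /submxP [w uE]; set N := kermx M1 in uE.
have [delta d0 du] : exists2 delta : R, 0 < delta &
    forall i, u 0 i != 0 -> delta <= `|u 0 i|.
  exists (\big[Num.min/1]_(i | u 0 i != 0) `|u 0 i|).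
    by apply: lt_bigmin => // i; rewrite normr_gt0.
  by move=> i ui; apply: bigmin_le_cond.
(* B exceeds every column sum of |N|, so changing each coefficient of w by less than delta / B moves
   each entry of u by less than delta. *)
pose B : R := 1 + \sum_i \sum_j `|ratr (N i j)|.
have B0 : 0 < B by rewrite ltr_pwDl // sumr_ge0 // => i _; rewrite sumr_ge0.
have /choice [w' w'P] : forall j, exists q : rat,
    w 0 j < ratr q < w 0 j + delta / B.
  move=> j; have [|q] := @rat_in_itvoo R (w 0 j) (w 0 j + delta / B).
    by rewrite ltrDl divr_gt0.
  by rewrite in_itv; exists q.
pose v := (\row_j w' j) *m N.
have vM1 : v *m M1 = 0 by rewrite -mulmxA mulmx_ker mulmx0.
have [vM vD] : v *m M = 0 /\ forall i, u 0 i = 0 -> v 0 i = 0.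
  move: vM1; rewrite mul_mx_row -[RHS]row_mx0 => /eq_row_mx [-> vD].
  split=> // i ui; have /rowP /(_ i) := vD.
  by rewrite mul_mx_diag !mxE ui eqxx mulr1.
exists v => // i; have [ui|ui] := eqVneq (u 0 i) 0.
  by rewrite vD // ui !ltxx.
have close : `|ratr (v 0 i) - u 0 i| < delta.
  rewrite uE !mxE rmorph_sum /= -sumrB.
  apply: le_lt_trans (ler_norm_sum _ _ _) _.
  apply: (@le_lt_trans _ _ (\sum_j delta / B * `|ratr (N j i)|)).
    apply: ler_sum => j _; rewrite !mxE rmorphM -mulrBl normrM ler_wpM2r //.
    have /andP[w1 w2] := w'P j.
    by rewrite ger0_norm ?subr_ge0 ?ltW // ltrBlDl.
  rewrite -mulr_sumr mulrAC ltr_pdivrMr // ltr_pM2l // /B.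
  rewrite -subr_gt0 -addrA ltr_pwDl // subr_ge0; apply: ler_sum => j _.
  by rewrite (bigD1 i) //= lerDl sumr_ge0.
have := lt_le_trans close (du i ui); rewrite ltr_norml => /andP[h1 h2].
rewrite -(ltr0q R) -(ltrq0 R).
have [u0|u0|u0] := ltgtP (u 0 i) 0; last by rewrite u0 eqxx in ui.
  move: h2; rewrite ltr0_norm // => h2; have v0 : ratr (v 0 i) < (0 : R) by lra.
  by rewrite v0 lt_gtF.
move: h1; rewrite gtr0_norm // => h1; have v0 : (0 : R) < ratr (v 0 i) by lra.
by rewrite v0 lt_gtF.
Qed.

Lemma int_kernel_sign (d m : nat) (M : 'M[int]_(d, m)) (u : 'rV[R]_d) :
  u *m map_mx intr M = 0 ->
  exists2 v : 'rV[int]_d, v *m M = 0 & 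
    forall i, (0 < v 0 i) = (0 < u 0 i) /\ (v 0 i < 0) = (u 0 i < 0).
Proof.
move=> uM; have [|v vM uv] := @rat_kernel_sign d m (map_mx intr M) u.
  by rewrite -map_mx_comp; rewrite -{}uM; congr (_ *m _); apply/matrixP => i j;
    rewrite !mxE /= ratr_int.
pose D := \prod_i denq (v 0 i).
pose z : 'rV[int]_d := \row_i (numq (v 0 i) * \prod_(j | j != i) denq (v 0 j)).
have D0 : 0 < D by apply: prodr_gt0 => i _; exact: denq_gt0.
have zE : map_mx intr z = D%:~R *: v.
  apply/rowP => i; rewrite !mxE /D [in RHS](bigD1 i) //=.
  by rewrite !intrM numqE [v 0 i * _]mulrC mulrAC.
exists z.
  have /rowP zM : map_mx (intr : int -> rat) (z *m M) = 0.
    by rewrite map_mxM zE -scalemxAl vM scaler0.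
  apply/rowP => j; move/(_ j): zM; rewrite mxE [in RHS]mxE => /eqP.
  by rewrite intr_eq0 => /eqP ->; rewrite mxE.
move=> i; have [<- <-] := uv i; have /rowP /(_ i) := zE.
rewrite mxE [in RHS]mxE => zi.
by rewrite -(ltr0z rat) -(ltrz0 rat) zi pmulr_rgt0 ?pmulr_rlt0 // ltr0z.
Qed.

Lemma prod_exp_lt (d : nat) (p q : 'I_d -> R) (a : 'I_d -> nat) (i0 : 'I_d) :
  (forall i, 0 <= q i) -> (forall i, (0 < a i)%N -> q i < p i) -> (0 < a i0)%N ->
  \prod_i q i ^+ a i < \prod_i p i ^+ a i.
Proof.
move=> q0 qp ai0; rewrite (bigD1 i0) // [ltRHS](bigD1 i0) //=.
have step i : 0 <= q i ^+ a i <= p i ^+ a i /\ 0 < p i ^+ a i.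
  rewrite exprn_ge0 //; case: (a i) (qp i) => [_|m /(_ isT) qpi].
    by rewrite !expr0 lexx ltr01.
  have pi0 := le_lt_trans (q0 i) qpi.
  by rewrite exprn_gt0 // lerXn2r ?nnegrE ?q0 // ltW.
apply: (@le_lt_trans _ _ (q i0 ^+ a i0 * \prod_(i | i != i0) p i ^+ a i)).
  rewrite ler_wpM2l ?exprn_ge0 //; apply: ler_prod => i _; exact: (step i).1.
rewrite ltr_pM2r; last by apply: prodr_gt0 => i _; exact: (step i).2.
by rewrite ltrXn2r -?lt0n ?q0 // qp.
Qed.

(* Uniqueness in Birch's theorem: an integral relation with the same sign
   pattern as [p - q] gives two incompatible strict inequalities. *)
Lemma binomial_barycentre_inj (d r : nat) (k : 'I_d -> 'rV[int]_r)
    (p q : 'I_d -> R) :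
  let binomials (p : 'I_d -> R) := forall a b : 'I_d -> nat,
    (\sum_i a i = \sum_i b i)%N -> \sum_i k i *+ a i = \sum_i k i *+ b i ->
    \prod_i p i ^+ a i = \prod_i p i ^+ b i in
  (forall i, 0 <= p i) -> (forall i, 0 <= q i) -> binomials p -> binomials q ->
  \sum_i p i = \sum_i q i ->
  \sum_i p i *: map_mx intr (k i) = \sum_i q i *: (map_mx intr (k i) : 'rV[R]_r) ->
  p =1 q.
Proof.
move=> binomials p0 q0 bp bq spq kpq.
(* The column of ones makes a kernel vector an affine relation among the k_i: its total vanishes as
   well as its moment. *)
pose M : 'M[int]_(d, 1 + r) := row_mx (const_mx 1) (\matrix_(i, j) k i 0 j).
pose u : 'rV[R]_d := \row_i (p i - q i).
have uM : u *m map_mx intr M = 0.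
  rewrite map_row_mx mul_mx_row -[RHS]row_mx0; congr row_mx.
    apply/rowP => j; rewrite !mxE; under eq_bigr do rewrite !mxE mulr1.
    by rewrite sumrB spq subrr.
  apply/rowP => j; rewrite !mxE; under eq_bigr do rewrite !mxE mulrBl.
  rewrite sumrB; move/rowP/(_ j): kpq; rewrite !summxE.
  under eq_bigr do rewrite !mxE; under [RHS]eq_bigr do rewrite !mxE.
  by move=> ->; rewrite subrr.
have [v vM uv] := int_kernel_sign uM.
have [sv vk] : \sum_i v 0 i = 0 /\ \sum_i v 0 i *: k i = 0.
  move: vM; rewrite mul_mx_row -[RHS]row_mx0 => /eq_row_mx [v1 v2]; split.
    have /rowP /(_ 0) := v1; rewrite !mxE; apply: etrans.
    by apply: eq_bigr => i _; rewrite !mxE mulr1.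
  apply/rowP => j; have /rowP /(_ j) := v2; rewrite !mxE summxE; apply: etrans.
  by apply: eq_bigr => i _; rewrite !mxE.
pose a i := if 0 < v 0 i then absz (v 0 i) else 0%N.
pose b i := if v 0 i < 0 then absz (v 0 i) else 0%N.
have vab i : v 0 i = (a i)%:Z - (b i)%:Z by rewrite /a /b; case: ltgtP => ?; lia.
have ab : (\sum_i a i = \sum_i b i)%N.
  apply/eqP; rewrite -eqz_nat -!natz !natr_sum -subr_eq0 -sumrB; apply/eqP.
  rewrite -[RHS]sv.
  by apply: eq_bigr => i _; rewrite vab !natz.
have kab : \sum_i k i *+ a i = \sum_i k i *+ b i.
  apply/eqP; rewrite -subr_eq0 -sumrB; apply/eqP; rewrite -[RHS]vk.
  by apply: eq_bigr => i _; rewrite vab scalerBl -!natz !scaler_nat.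
have qp i : (0 < a i)%N -> q i < p i.
  have [uvp _] := uv i; rewrite /a uvp mxE subr_gt0; by case: ifP.
have pq i : (0 < b i)%N -> p i < q i.
  have [_ uvn] := uv i; rewrite /b uvn mxE subr_lt0; by case: ifP.
have weak (p' q' : 'I_d -> R) (c : 'I_d -> nat) : (forall i, 0 <= q' i) ->
    (forall i, (0 < c i)%N -> q' i < p' i) ->
    \prod_i q' i ^+ c i <= \prod_i p' i ^+ c i.
  move=> q'0 qp'; have [/existsP [i ci]|] := boolP [exists i, (0 < c i)%N].
    by apply/ltW/(prod_exp_lt q'0 qp' ci).
  rewrite negb_exists => /forallP c0.
  have cE i : c i = 0%N by apply/eqP; rewrite -leqn0 leqNgt.
  by under eq_bigr do rewrite cE expr0; under [leRHS]eq_bigr do rewrite cE expr0.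
(* If p_i < q_i then b_i > 0 and p^b < q^b. The binomials turn this into p^a < q^a, against q < p on
   the support of a. The other case exchanges the roles. *)
move=> i; have [pqi|qpi|//] := ltgtP (p i) (q i).
  have bi : (0 < b i)%N.
    by have := (uv i).2; rewrite /b mxE subr_lt0 pqi => vi; rewrite vi; lia.
  have := prod_exp_lt p0 pq bi; rewrite -(bp a b) // -(bq a b) // ltNge.
  by rewrite weak.
have ai : (0 < a i)%N.
  by have := (uv i).1; rewrite /a mxE subr_gt0 qpi => vi; rewrite vi; lia.
have := prod_exp_lt q0 qp ai; rewrite (bp a b) // (bq a b) // ltNge.
by rewrite weak.
Qed.

End IntegerKernel.

(** * Growth estimate and averaging over roots of unity *)

Section Averaging.

(** By Bernoulli, theta <= tau^(r+1) for tau = 1 - h, and c n + 1 <= (1 + h)^n for a suitable n.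
    Then (c n + 1) tau^n <= (1 - h^2)^n <= 1 absorbs the r polynomial factors, and one factor tau^n
    < 1 remains. *)
Lemma poly_times_geometric_lt1 (R : archiRealFieldType) (r c : nat) (theta : R) :
  0 <= theta < 1 -> exists n : nat, ((c * n).+1)%:R ^+ r * theta ^+ n < 1.
Proof.
move=> /andP[theta0 theta1].
have bernoulli (x : R) n : -1 <= x -> 1 + n%:R * x <= (1 + x) ^+ n.
  move=> x1; elim: n => [|n IHn]; first by rewrite mul0r addr0.
  have x10 : 0 <= 1 + x by lra.
  apply: le_trans (_ : (1 + x) * (1 + n%:R * x) <= _).
    have := mulr_ge0 (ler0n R n) (sqr_ge0 x); rewrite -natr1; nra.
  by rewrite exprS ler_wpM2l.
pose h : R := (1 - theta) / r.+1%:R.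
have r0 : 0 < r.+1%:R :> R by rewrite ltr0n.
have h0 : 0 < h by rewrite divr_gt0 // subr_gt0.
have hr : r.+1%:R * h = 1 - theta by rewrite mulrC divfK // gt_eqF.
have h1 : h <= 1.
  by rewrite ler_pdivrMr // mul1r -natr1; have := ler0n R r; lra.
pose tau : R := 1 - h.
have tau0 : 0 <= tau by rewrite subr_ge0.
have tau1 : tau < 1 by rewrite /tau; lra.
have theta_tau : theta <= tau ^+ r.+1.
  have := @bernoulli (- h) r.+1; rewrite mulrN hr; lra.
(* Squaring Bernoulli for the exponent m, with n = 2 m, gives the quadratic bound (m h)^2, which
   beats c n + 1 <= m (2 c + 1). *)
pose m := (Num.truncn ((2 * c + 1)%:R / h ^+ 2)).+1.
have mh : (2 * c + 1)%:R <= m%:R * h ^+ 2.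
  by rewrite -ler_pdivrMr ?exprn_gt0 // ltW // /m truncnS_gt.
pose n := (2 * m)%N.
have grow : (c * n).+1%:R <= (1 + h) ^+ n.
  have mh1 : 0 <= m%:R * h by rewrite mulr_ge0 ?ler0n // ltW.
  apply: (@le_trans _ _ ((m%:R * h) ^+ 2)).
    apply: (@le_trans _ _ (m%:R * (2 * c + 1)%:R)).
      by rewrite -natrM ler_nat /n /m; lia.
    by rewrite exprMn [m%:R ^+ 2]expr2 -mulrA ler_wpM2l // ler0n.
  rewrite /n mulnC exprM lerXn2r ?nnegrE ?exprn_ge0 ?addr_ge0 ?ler01 ?(ltW h0) //.
  have := @bernoulli h m; lra.
have ctau : (c * n).+1%:R * tau ^+ n <= 1.
  apply: (@le_trans _ _ ((1 + h) ^+ n * tau ^+ n)).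
    by rewrite ler_wpM2r // exprn_ge0.
  rewrite -exprMn exprn_ile1 //; first by rewrite mulr_ge0 // addr_ge0 // ltW.
  by rewrite /tau; nra.
exists n; apply: (@le_lt_trans _ _ (((c * n).+1%:R * tau ^+ n) ^+ r * tau ^+ n)).
  rewrite exprMn -mulrA ler_wpM2l ?exprn_ge0 ?ler0n //.
  rewrite -exprM -exprD -mulnSr mulnC exprM.
  by rewrite lerXn2r // ?nnegrE // exprn_ge0.
apply: (@le_lt_trans _ _ (tau ^+ n)); last by rewrite exprn_ilt1 // /n /m.
rewrite -[leRHS]mul1r ler_wpM2r ?exprn_ge0 // exprn_ile1 //.
by rewrite mulr_ge0 ?exprn_ge0 ?ler0n.
Qed.

Lemma prim_root_exists (F : numClosedFieldType) (n : nat) :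
  (0 < n)%N -> exists z : F, n.-primitive_root z.
Proof.
move=> n0; have [s sE] := closed_field_poly_normal ('X^n - 1 : {poly F}).
rewrite (monicP _) ?monicXnsubC // scale1r in sE.
have /hasP [z _ zn] : has n.-primitive_root s; last by exists z.
apply: has_prim_root => //.
- by apply/allP => z; rewrite -root_prod_XsubC -sE.
- by rewrite -separable_prod_XsubC -sE separable_Xn_sub_1 // pnatr_eq0 -lt0n.
- by rewrite -ltnS -(size_prod_XsubC s id) -sE size_XnsubC.
Qed.

(** The sum over the n-torsion points is a product over the coordinates. Where v_j is nonzero the
    factor is a geometric sum whose ratio z^(v_j) is an n-th root of unity, different from 1 because
    |v_j| < n. *)
Lemma sum_prim_root_character (F : fieldType) (r n : nat) (z : F) (v : 'rV[int]_r) :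
  n.-primitive_root z -> (forall j, `|v 0 j| < n%:Z) -> v != 0 ->
  \sum_(c : {ffun 'I_r -> 'I_n}) \prod_j (z ^+ c j) ^ v 0 j = 0.
Proof.
move=> zn vn v0; have n0 := prim_order_gt0 zn.
have z0 : z != 0 by rewrite (prim_root_eq0 zn) -lt0n.
rewrite -(bigA_distr_bigA (fun j (c : 'I_n) => (z ^+ c) ^ v 0 j)).
have /existsP [j vj] : [exists j, v 0 j != 0].
  apply: contraNT v0; rewrite negb_exists => /forallP v0.
  by apply/eqP/rowP => j; rewrite mxE; apply/eqP; rewrite -[_ == _]negbK.
apply/eqP; rewrite prodf_seq_eq0; apply/hasP; exists j; rewrite ?mem_index_enum //=.
pose y := z ^ v 0 j.
have -> : \sum_(c < n) (z ^+ c) ^ v 0 j = \sum_(c < n) y ^+ c.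
  by apply: eq_bigr => c _; rewrite /y [RHS]exprnP [z ^+ c]exprnP !exprz_exp mulrC.
have y1 : y != 1.
  apply/eqP => y1.
  have : z ^+ absz (v 0 j) = 1.
    move: y1; rewrite /y; case: (v 0 j) => a; first by [].
    by move=> /(congr1 GRing.inv); rewrite /exprz invrK invr1.
  move/eqP; rewrite -(prim_order_dvd zn) => /dvdn_leq.
  by have := vn j; move: vj; lia.
have : (y - 1) * (\sum_(c < n) y ^+ c) = 0.
  rewrite -subrX1 /y [_ ^+ n]exprnP exprz_exp mulrC -exprz_exp -exprnP.
  by rewrite prim_expr_order // exp1rz subrr.
by move/eqP; rewrite mulf_eq0 subr_eq0 (negPf y1).
Qed.

(** Averaging against the inverse character of w over the n-torsion points of the unit torus
    isolates e(w), as soon as n exceeds the entries of all differences w' - w; and an average of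
    terms bounded by B is bounded by B. *)
Lemma laurent_coeff_le (R : realType) (r : nat) (L : seq 'rV[int]_r)
    (e : 'rV[int]_r -> R[i]) (B : R[i]) :
  uniq L ->
  (forall lambda : 'I_r -> R[i], (forall j, `|lambda j| = 1) ->
     `|\sum_(w <- L) torus_char w lambda * e w| <= B) ->
  {in L, forall w, `|e w| <= B}.
Proof.
move=> uL fB w wL.
pose n := (\sum_(w' <- L) \sum_j absz (w' 0 j - w 0 j)%R).+1.
have [z zn] := @prim_root_exists R[i] n isT.
have z0 : z != 0 by rewrite (prim_root_eq0 zn).
have z1 : `|z| = 1.
  have : `|z| ^+ n = 1 by rewrite -normrX (prim_expr_order zn) normr1.
  by move/eqP; rewrite pexpr_eq1 // => /eqP.
pose lam (c : {ffun 'I_r -> 'I_n}) j : R[i] := z ^+ c j.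
have lam1 c j : `|lam c j| = 1 by rewrite /lam normrX z1 expr1n.
have lam0 c j : lam c j != 0 by rewrite -normr_eq0 lam1 oner_eq0.
have char1 c w' : `|torus_char w' (lam c)| = 1.
  rewrite /torus_char normr_prod big1 // => j _.
  by case: (w' 0 j) => m; rewrite /exprz ?normfV normrX lam1 expr1n ?invr1.
have n0 : 0 < (n ^ r)%:R :> R[i] by rewrite ltr0n expn_gt0.
rewrite -(ler_pM2l n0).
have -> : (n ^ r)%:R * `|e w| = `|\sum_c torus_char (- w) (lam c) *
    \sum_(w' <- L) torus_char w' (lam c) * e w'|.
  rewrite -[in LHS](ger0_norm (ltW n0)) -normrM; congr `|_|.
  under eq_bigr do rewrite mulr_sumr.
  rewrite exchange_big /= (bigD1_seq w) //= [X in _ = _ + X]big1_seq ?addr0.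
    under eq_bigr => c _.
      rewrite mulrA [X in X * _](_ : _ = 1) ?mul1r; first over.
      rewrite /torus_char -big_split big1 //= => j _.
      by rewrite mxE -expfzDr // addNr expr0z.
    rewrite sumr_const card_ffun !card_ord; exact: mulr_natl.
  move=> w' /andP[w'w w'L]; under eq_bigr do rewrite mulrA.
  rewrite -mulr_suml [X in X * _](_ : _ = 0) ?mul0r //.
  rewrite -[RHS](sum_prim_root_character (v := w' - w) zn).
  - apply: eq_bigr => c _; rewrite /torus_char -big_split; apply: eq_bigr => j _ /=.
    by rewrite !mxE -expfzDr // addrC.
  - move=> j; rewrite !mxE /n (big_rem w') //= (bigD1 j) //=.
    rewrite -abszE ltz_nat; lia.
  - by rewrite subr_eq0.
apply: le_trans (ler_norm_sum _ _ _) _.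
apply: (@le_trans _ _ (\sum_(c : {ffun 'I_r -> 'I_n}) B)).
  by apply: ler_sum => c _; rewrite normrM char1 mul1r fB.
by rewrite sumr_const card_ffun !card_ord mulr_natl.
Qed.

(** Shifting by kappa places every entry among the 2 kappa + 1 values 0, ..., 2 kappa. *)
Lemma size_bounded_weights (r kappa : nat) (L : seq 'rV[int]_r) :
  uniq L -> (forall w, w \in L -> forall j, (absz (w 0%R j) <= kappa)%N) ->
  (size L <= (2 * kappa).+1 ^ r)%N.
Proof.
move=> uL Lk.
pose f (w : 'rV[int]_r) : {ffun 'I_r -> 'I_(2 * kappa).+1} :=
  [ffun j => inord (absz (w 0 j + kappa%:Z)%R)].
rewrite -(size_map f) -[X in (_ <= X ^ _)%N](card_ord (2 * kappa).+1).
rewrite -[X in (_ <= _ ^ X)%N](card_ord r) -card_ffun.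
have /card_uniqP <- : uniq (map f L); last exact: max_card.
rewrite map_inj_in_uniq // => w w' /Lk wk /Lk w'k /ffunP ff.
apply/rowP => j; have := congr1 val (ff j); rewrite !ffunE /=.
by move: (w 0 j) (w' 0 j) (wk j) (w'k j) => a b ak bk; rewrite !inordK; lia.
Qed.

End Averaging.

From mathcomp Require Import ring_quotient mpoly.

Local Open Scope quotient_scope.

(** * The toric ring as a graded semigroup algebra with torus action *)

Section ToricRingTheory.
Variables (R : realType) (r d : nat) (k : 'I_d -> 'rV[int]_r).
Local Notation C := R[i].
Local Notation P := {mpoly C[d]}.
Local Notation toric_ring := (toric_ring R k).

Definition mnm_weight (u : 'X_{1..d}) : 'rV[int]_r := \sum_i k i *+ u i.

Lemma mnm_weightD u v : mnm_weight (u + v)%MM = mnm_weight u + mnm_weight v.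
Proof. by rewrite -big_split; apply: eq_bigr => i _; rewrite mnmDE mulrnDr. Qed.

Lemma mnm_weight1 i : mnm_weight U_(i)%MM = k i.
Proof.
rewrite /mnm_weight (bigD1 i) //= mnm1E eqxx big1 ?addr0 // => j ji.
by rewrite mnm1E eq_sym (negPf ji).
Qed.

Lemma mnm_weight_sum (I : Type) (s : seq I) (F : I -> 'X_{1..d}) :
  mnm_weight (\sum_(i <- s) F i)%MM = \sum_(i <- s) mnm_weight (F i).
Proof.
elim: s => [|i s IHs]; last by rewrite !big_cons mnm_weightD IHs.
by rewrite !big_nil /mnm_weight big1 // => j _; rewrite mnm0E.
Qed.

Lemma mnm_sum_units (u : 'X_{1..d}) (p : nat) : mdeg u = p ->
  exists i : 'I_p -> 'I_d, u = (\sum_a U_(i a))%MM.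
Proof.
elim: p u => [|p IHp] u up.
  exists (fun a : 'I_0 => False_rect _ (notF (ltn_ord a))); rewrite big_ord0.
  by apply/eqP; rewrite -mdeg_eq0 up.
have /existsP [i ui] : [exists i, u i != 0%N].
  apply: contra_eqT up; rewrite negb_exists => /forallP u0.
  by rewrite mdegE big1 // => i _; apply/eqP; rewrite -[_ == _]negbK.
have Uu : (U_(i) <= u)%MM.
  by apply/mnm_lepP => j; rewrite mnm1E; case: eqVneq => // <-; rewrite lt0n.
have [|f fE] := IHp (u - U_(i))%MM.
  by have := congr1 mdeg (submK Uu); rewrite mdegD mdeg1 up; lia.
exists (fun a => oapp f i (unlift ord0 a)); rewrite big_ord_recl unlift_none /=.
under eq_bigr do rewrite liftK.
by rewrite -fE addmC submK.
Qed.

(** The definition uses words of p generators; grouping equal letters turns such a word into an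
    exponent vector of degree p. *)
Lemma toric_relationP (q : P) :
  toric_relation k q <-> exists u v : 'X_{1..d},
    [/\ mdeg u = mdeg v, mnm_weight u = mnm_weight v & q = 'X_[u] - 'X_[v]].
Proof.
split=> [[p [i [j [ij ->]]]]|[u [v [uv wuv ->]]]].
  exists (\sum_a U_(i a))%MM, (\sum_a U_(j a))%MM; split.
  - by rewrite !mdeg_sum; apply: eq_bigr => a _; rewrite !mdeg1.
  - rewrite !mnm_weight_sum; under eq_bigr do rewrite mnm_weight1.
    by under [RHS]eq_bigr do rewrite mnm_weight1.
  - by rewrite -!mprodXE.
have [p vp] : exists p, mdeg v = p by exists (mdeg v).
have [i ui] := mnm_sum_units (etrans uv vp); have [j vj] := mnm_sum_units vp.
exists p, i, j; split; last by rewrite !mprodXE -ui -vj.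
move: wuv; rewrite ui vj !mnm_weight_sum; under eq_bigr do rewrite mnm_weight1.
by under [RHS]eq_bigr do rewrite mnm_weight1.
Qed.

Lemma specP (x : 'rV[C]_d) :
  spec k x <-> forall u v : 'X_{1..d}, mdeg u = mdeg v ->
    mnm_weight u = mnm_weight v -> \prod_i x 0 i ^+ u i = \prod_i x 0 i ^+ v i.
Proof.
split=> [sx u v uv wuv|sx q /asboolP [n [a [g [gG ->]]]]].
  suff /sx : ('X_[u] - 'X_[v] : P) \in toric_ideal k.
    by rewrite mevalB !mevalX => /eqP; rewrite subr_eq0 => /eqP.
  apply/asboolP; exists 1%N, (fun=> 1), (fun=> 'X_[u] - 'X_[v]).
  split=> [_|]; first by apply/toric_relationP; exists u, v.
  by rewrite big_ord1 mul1r.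
rewrite raddf_sum big1 // => i _ /=.
have /toric_relationP [u [v [uv wuv ->]]] := gG i.
by rewrite mevalM mevalB !mevalX (sx u v) // subrr mulr0.
Qed.

Lemma toric_pi_eq (p q : P) :
  (\pi_toric_ring p = \pi_toric_ring q) <-> (p - q \in toric_ideal k).
Proof.
split=> [e|h]; first by rewrite Quotient.idealrBE e.
by apply/eqP; rewrite -Quotient.idealrBE.
Qed.

Lemma toric_repr_pi (q : P) :
  repr (\pi_toric_ring q) - q \in toric_ideal k.
Proof. by apply/toric_pi_eq; rewrite reprK. Qed.

Lemma toric_eval_pi (x : 'rV[C]_d) (q : P) : spec k x ->
  toric_eval x (\pi_toric_ring q) = q.@[x 0].
Proof.
move=> /(_ _ (toric_repr_pi q)); rewrite mevalB => /eqP.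
by rewrite subr_eq0 => /eqP.
Qed.

Definition coeff_sum (Q : pred 'X_{1..d}) (q : P) : C :=
  \sum_(u <- msupp q | Q u) q@_u.

Lemma coeff_sumE (Q : pred 'X_{1..d}) (q : P) (s : seq 'X_{1..d}) :
  uniq s -> {subset msupp q <= s} -> coeff_sum Q q = \sum_(u <- s | Q u) q@_u.
Proof.
move=> us qs; rewrite [RHS](bigID (mem (msupp q))) /= addrC big1 ?add0r.
  rewrite /coeff_sum -[LHS]big_filter -[RHS]big_filter; apply: perm_big.
  apply: uniq_perm; rewrite ?filter_uniq ?msupp_uniq // => u.
  rewrite !mem_filter; case: (boolP (u \in msupp q)) => [/qs ->|_].
    by rewrite !andbT.
  by rewrite !andbF.
by move=> u /andP[_ /memN_msupp_eq0].
Qed.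

Lemma coeff_sumD (Q : pred 'X_{1..d}) (a b : P) :
  coeff_sum Q (a + b) = coeff_sum Q a + coeff_sum Q b.
Proof.
pose s := undup (msupp (a + b) ++ msupp a ++ msupp b).
have sub t : {subset t <= msupp (a + b) ++ msupp a ++ msupp b} ->
    {subset t <= s} by move=> ts u /ts; rewrite mem_undup.
rewrite !(@coeff_sumE Q _ s) ?undup_uniq //.
- by rewrite -big_split; apply: eq_bigr => u _; rewrite mcoeffD.
- by apply: sub => u ub; rewrite !mem_cat ub !orbT.
- by apply: sub => u ua; rewrite !mem_cat ua !orbT.
- by apply: sub => u uab; rewrite mem_cat uab.
Qed.

Lemma coeff_sumZ (Q : pred 'X_{1..d}) (c : C) (q : P) :
  coeff_sum Q (c *: q) = c * coeff_sum Q q.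
Proof.
rewrite (@coeff_sumE Q _ (msupp q)) ?msupp_uniq //; last exact: msuppZ_le.
by rewrite mulr_sumr; apply: eq_bigr => u _; rewrite mcoeffZ.
Qed.

Lemma coeff_sum0 (Q : pred 'X_{1..d}) : coeff_sum Q 0 = 0.
Proof. by rewrite -(scale0r 0) coeff_sumZ mul0r. Qed.

Lemma coeff_sumB (Q : pred 'X_{1..d}) (a b : P) :
  coeff_sum Q (a - b) = coeff_sum Q a - coeff_sum Q b.
Proof. by rewrite -scaleN1r coeff_sumD coeff_sumZ mulN1r. Qed.

Lemma coeff_sum_sum (Q : pred 'X_{1..d}) (I : Type) (s : seq I) (F : I -> P) :
  coeff_sum Q (\sum_(i <- s) F i) = \sum_(i <- s) coeff_sum Q (F i).
Proof.
elim: s => [|i s IHs]; first by rewrite !big_nil coeff_sum0.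
by rewrite !big_cons coeff_sumD IHs.
Qed.

Lemma coeff_sumX (Q : pred 'X_{1..d}) (u : 'X_{1..d}) :
  coeff_sum Q 'X_[u] = (Q u)%:R.
Proof.
rewrite /coeff_sum msuppX big_mkcond big_seq1 mcoeffX eqxx.
by case: (Q u).
Qed.

Definition bidegree (u : 'X_{1..d}) := (mdeg u, mnm_weight u).

(* C[A] is a semigroup algebra; these functionals are its coordinates. *)
Lemma coeff_sum_toric_ideal t (q : P) : q \in toric_ideal k ->
  coeff_sum (fun u => bidegree u == t) q = 0.
Proof.
move=> /asboolP [n [a [g [gG ->]]]]; rewrite coeff_sum_sum big1 // => i _.
have /toric_relationP [u [v [uv wuv ->]]] := gG i.
rewrite (mpolyE (a i)) mulr_suml coeff_sum_sum big1 // => m _.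
rewrite -scalerAl coeff_sumZ mulrBr -!mpolyXD coeff_sumB !coeff_sumX.
by rewrite /bidegree !mdegD !mnm_weightD uv wuv subrr mulr0.
Qed.

Lemma coeff_sum_pi t (p q : P) : \pi_toric_ring p = \pi_toric_ring q ->
  coeff_sum (fun u => bidegree u == t) p = coeff_sum (fun u => bidegree u == t) q.
Proof.
move=> /toric_pi_eq /(coeff_sum_toric_ideal t); rewrite coeff_sumB => /eqP.
by rewrite subr_eq0 => /eqP.
Qed.

Lemma torus_charD (w w' : 'rV[int]_r) (lambda : 'I_r -> C) :
  (forall j, lambda j != 0) ->
  torus_char (w + w') lambda = torus_char w lambda * torus_char w' lambda.
Proof.
move=> l0; rewrite /torus_char -big_split; apply: eq_bigr => j _ /=.
by rewrite mxE expfzDr.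
Qed.

Lemma torus_char_mnm (u : 'X_{1..d}) (lambda : 'I_r -> C) :
  (forall j, lambda j != 0) ->
  torus_char (mnm_weight u) lambda = \prod_i torus_char (k i) lambda ^+ u i.
Proof.
move=> l0; have char0 : torus_char 0 lambda = 1.
  by rewrite /torus_char big1 // => j _; rewrite mxE expr0z.
rewrite /mnm_weight; elim/big_ind2: _ => [//|x1 x2 y1 y2 e1 e2|i _].
  by rewrite torus_charD // e1 e2.
elim: (u i) => [|m IHm]; first by rewrite mulr0n expr0.
by rewrite mulrS exprS torus_charD // IHm.
Qed.

Definition torus_subst (lambda : 'I_r -> C) (q : P) : P :=
  q \mPo [tuple torus_char (k i) lambda *: 'X_i | i < d].

Lemma torus_substX (lambda : 'I_r -> C) (u : 'X_{1..d}) :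
  (forall j, lambda j != 0) ->
  torus_subst lambda 'X_[u] = torus_char (mnm_weight u) lambda *: 'X_[u].
Proof.
move=> l0; rewrite /torus_subst comp_mpolyX torus_char_mnm // mpolyXE_id.
rewrite -scaler_prod; apply: eq_bigr => i _.
by rewrite tnth_mktuple exprZn.
Qed.

Lemma torus_substE (lambda : 'I_r -> C) (q : P) :
  (forall j, lambda j != 0) -> torus_subst lambda q =
  \sum_(u <- msupp q) (q@_u * torus_char (mnm_weight u) lambda) *: 'X_[u].
Proof.
move=> l0; rewrite {1}(mpolyE q) /torus_subst raddf_sum; apply: eq_bigr => u _ /=.
by rewrite comp_mpolyZ -/(torus_subst _ _) torus_substX // scalerA.
Qed.

Lemma torus_subst_ideal (lambda : 'I_r -> C) (q : P) :
  (forall j, lambda j != 0) ->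
  q \in toric_ideal k -> torus_subst lambda q \in toric_ideal k.
Proof.
move=> l0 /asboolP [n [a [g [gG ->]]]]; rewrite /torus_subst raddf_sum rpred_sum //.
move=> i _ /=; have /toric_relationP [u [v [uv wuv gE]]] := gG i.
rewrite rmorphM /= gE rmorphB /= -!/(torus_subst _ _) !torus_substX // wuv -scalerBr.
rewrite -scalerAr scalerAl idealMr //; apply/asboolP.
exists 1%N, (fun=> 1), (fun=> g i).
by split=> //; rewrite big_ord1 mul1r gE.
Qed.

(** [torus_act] is defined through the chosen representative; the substitution preserves the toric
    ideal, so any representative may be used. *)
Lemma torus_act_pi (lambda : 'I_r -> C) (q : P) :
  (forall j, lambda j != 0) ->
  torus_act lambda (\pi_toric_ring q) = \pi_toric_ring (torus_subst lambda q).
Proof.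
move=> l0; apply/toric_pi_eq; rewrite -/(torus_subst _ _) /torus_subst -raddfB.
exact: torus_subst_ideal (toric_repr_pi q).
Qed.

Lemma coeff_sum_torus_subst (lambda : 'I_r -> C) p w (q : P) :
  (forall j, lambda j != 0) ->
  coeff_sum (fun u => bidegree u == (p, w)) (torus_subst lambda q) =
  torus_char w lambda * coeff_sum (fun u => bidegree u == (p, w)) q.
Proof.
move=> l0; rewrite torus_substE // coeff_sum_sum [in RHS]/coeff_sum mulr_sumr.
rewrite [RHS]big_mkcond.
apply: eq_bigr => u _; rewrite coeff_sumZ coeff_sumX.
by case: eqP => [[_ ->]|_]; rewrite ?mulr0 // mulr1 mulrC.
Qed.

(** Let w' and w differ at j. The torus point with entry 2 at j and 1 elsewhere multiplies this
    coordinate of m by 2^(w'_j), and also by 2^(w_j) as m has weight w; these factors differ, so the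
    coordinate is 0. *)
Lemma weight_vector_coeff_sum w (m : toric_ring) p w' : weight_vector w m ->
  w' != w -> coeff_sum (fun u => bidegree u == (p, w')) (repr m) = 0.
Proof.
move=> wm ww'.
have /existsP [j wj] : [exists j, w' 0 j != w 0 j].
  apply: contraNT ww'; rewrite negb_exists => /forallP ww'.
  by apply/eqP/rowP => j; apply/eqP; rewrite -[_ == _]negbK.
pose lambda (i : 'I_r) : C := if i == j then 2 else 1.
have l0 i : lambda i != 0 by rewrite /lambda; case: ifP; rewrite ?pnatr_eq0 ?oner_eq0.
have charE v : torus_char v lambda = ((2 : R) ^ v 0 j)%:C%C.
  rewrite /torus_char (bigD1 j) //= big1 => [|i ij].
    rewrite mulr1 /lambda eqxx -(rmorph_nat (real_complex R)).
    by rewrite rmorphXz // unitfE pnatr_eq0.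
  by rewrite /lambda (negPf ij) exp1rz.
have := wm lambda l0; rewrite -[X in torus_act _ X]reprK -[X in _ = _ * X]reprK.
rewrite torus_act_pi // -rmorphM => /(coeff_sum_pi (p, w')).
rewrite coeff_sum_torus_subst // mul_mpolyC coeff_sumZ => /eqP.
rewrite -subr_eq0 -mulrBl mulf_eq0 !charE subr_eq0 => /orP [|/eqP //].
move=> /eqP /complexI /ieexprIz wjE; move: wj; rewrite wjE ?eqxx //.
by rewrite pnatr_eq1.
Qed.

End ToricRingTheory.

(** * A zero over a point excludes lopsidedness *)

Section NotLopsided.
Variables (R : realType) (r d : nat) (k : 'I_d -> 'rV[int]_r).
Local Notation C := R[i].
Local Notation P := {mpoly C[d]}.
Local Notation toric_ring := (toric_ring R k).

Lemma lopsided_enum (l : nat) (g : 'I_l -> R) :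
  lopsided [seq g i | i <- enum 'I_l] <->
  exists i, \sum_(j | j != i) g j < g i.
Proof.
set s := map _ _; have sl : size s = l by rewrite size_map size_enum_ord.
have sg (i : 'I_l) : s`_i = g i.
  by rewrite (nth_map i) ?size_enum_ord // nth_ord_enum.
clearbody s; move: g sg; case: l / sl => g sg.
have gE i : (\sum_(j < size s | j != i) s`_j < s`_i) = (\sum_(j | j != i) g j < g i).
  by rewrite sg; under eq_bigr do rewrite sg.
by split; case=> i gi; exists i; rewrite ?gE // -gE.
Qed.

Lemma normc_ge0 (z : C) : 0 <= Normc.normc z.
Proof. by case: z => a b; exact: sqrtr_ge0. Qed.

Lemma normc_sum_le (I : Type) (s : seq I) (Q : pred I) (F : I -> C) :
  Normc.normc (\sum_(i <- s | Q i) F i) <= \sum_(i <- s | Q i) Normc.normc (F i).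
Proof.
rewrite -lecR rmorph_sum /=.
exact: ler_norm_sum s F Q.
Qed.

Lemma normc_prodX (I : Type) (s : seq I) (F : I -> C) (u : I -> nat) :
  Normc.normc (\prod_(i <- s) F i ^+ u i) = \prod_(i <- s) Normc.normc (F i) ^+ u i.
Proof.
apply: complexI; rewrite rmorph_prod /=.
transitivity `|\prod_(i <- s) F i ^+ u i| => //.
by rewrite normr_prod; apply: eq_bigr => i _; rewrite normrX rmorphXn.
Qed.

Lemma big_undup_fibers (V : nmodType) (I T : eqType) (s : seq I) (f : I -> T)
    (F : I -> V) :
  \sum_(i <- s) F i = \sum_(t <- undup (map f s)) \sum_(i <- s | f i == t) F i.
Proof.
rewrite (exchange_big_dep xpredT) //= big_seq [RHS]big_seq; apply: eq_bigr => i si.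
rewrite -big_filter; have -> : [seq t <- undup (map f s) | f i == t] = [:: f i].
  under eq_filter do rewrite eq_sym.
  by rewrite filter_pred1_uniq ?undup_uniq // mem_undup map_f.
by rewrite big_seq1.
Qed.

(** On the cone all monomials of one bidegree agree, so q is its coefficient sum in bidegree (p, w)
    times any one of them. The alternative a = 0 serves the case where no monomial of q has that
    bidegree. *)
Lemma meval_bihomogeneous p w (q : P) :
  (forall t, t != (p, w) -> coeff_sum (fun u => bidegree k u == t) q = 0) ->
  exists (a : C) (u : 'X_{1..d}), (a = 0 \/ mdeg u = p) /\
    forall z, spec k z -> q.@[z 0] = a * \prod_i z 0 i ^+ u i.
Proof.
move=> q0; pose cls := undup (map (bidegree k) (msupp q)).
have qE z : spec k z -> q.@[z 0] = \sum_(t <- cls)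
    \sum_(u <- msupp q | bidegree k u == t) q@_u * \prod_i z 0 i ^+ u i.
  by move=> _; rewrite mevalE; exact: big_undup_fibers.
have fiber z u t : spec k z -> bidegree k u = t ->
    \sum_(u <- msupp q | bidegree k u == t) q@_u * \prod_i z 0 i ^+ u i =
    coeff_sum (fun u => bidegree k u == t) q * \prod_i z 0 i ^+ u i.
  move=> /specP sz ut; rewrite mulr_suml; apply: eq_bigr => v /eqP vt.
  by case: ut vt => <- [vu wvu]; rewrite (sz v u).
have others z t : spec k z -> t \in cls -> t != (p, w) ->
    \sum_(u <- msupp q | bidegree k u == t) q@_u * \prod_i z 0 i ^+ u i = 0.
  move=> sz; rewrite mem_undup => /mapP [u _ tu] /q0 t0.
  by rewrite (fiber z u t sz (esym tu)) t0 mul0r.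
have [|npw] := boolP ((p, w) \in cls).
  rewrite mem_undup => /mapP [u uq pw].
  exists (coeff_sum (fun u => bidegree k u == (p, w)) q), u; split.
    by right; case: pw.
  move=> z sz; rewrite qE // (bigD1_seq (p, w)) ?undup_uniq //=; last first.
    by rewrite mem_undup pw map_f.
  rewrite (fiber z u) // [X in _ + X]big1_seq ?addr0 // => t /andP[tpw tcls].
  exact: others.
exists 0, 0%MM; split=> [|z sz]; first by left.
rewrite mul0r qE // big1_seq // => t /andP[_ tcls]; apply: others => //.
by apply: contraNneq npw => <-.
Qed.

(** The weights being distinct, only m_i contributes to the coordinate of f in bidegree (p', w_i),
    and homogeneity of q makes that coordinate 0 for p' != p. So each weight component inherits the
    degree p. *)
Lemma weight_decomposition_bihomogeneous p (q : P) (l : nat) (m : 'I_l -> toric_ring) :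
  q \is p.-homog -> weight_decomposition (\pi_toric_ring q) m ->
  exists w : 'I_l -> 'rV[int]_r, forall i t, t != (p, w i) ->
    coeff_sum (fun u => bidegree k u == t) (repr (m i)) = 0.
Proof.
move=> qp [qm [w [w_inj mw]]]; exists w => i [p' w'] tpw.
have [w'w|w'w] := eqVneq w' (w i); last first.
  exact: weight_vector_coeff_sum (mw i).2 w'w.
have p'p : p' != p by apply: contraNneq tpw => ->; rewrite w'w.
have : \pi_toric_ring q = \pi_toric_ring (\sum_j repr (m j)).
  by rewrite qm raddf_sum; apply: eq_bigr => j _ /=; rewrite reprK.
move/(coeff_sum_pi (p', w')); rewrite coeff_sum_sum (bigD1 i) //= [X in _ + X]big1.
  rewrite addr0 => <-; rewrite /coeff_sum big1_seq // => u /andP[/eqP [up _] uq].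
  by move: p'p; rewrite -up (dhomog_mf qp uq) eqxx.
move=> j ji; apply: weight_vector_coeff_sum (mw j).2 _.
by rewrite w'w (inj_eq w_inj) eq_sym.
Qed.

Lemma toric_eval_lincomb (x : 'rV[C]_d) (n : nat) (a g : 'I_n -> toric_ring) :
  spec k x ->
  toric_eval x (\sum_i a i * g i) = \sum_i toric_eval x (a i) * toric_eval x (g i).
Proof.
move=> sx.
have -> : \sum_i a i * g i = \pi_toric_ring (\sum_i repr (a i) * repr (g i)).
  by rewrite raddf_sum; apply: eq_bigr => i _ /=; rewrite rmorphM /= !reprK.
by rewrite toric_eval_pi // raddf_sum; apply: eq_bigr => i _ /=; rewrite mevalM.
Qed.

Lemma vanishing_ideal_gen (G : set toric_ring) (x : 'rV[C]_d) :
  spec k x -> (forall f, G f -> toric_eval x f = 0) ->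
  forall f, ideal_gen G f -> toric_eval x f = 0.
Proof.
move=> sx Gx f [n [a [g [gG ->]]]]; rewrite toric_eval_lincomb // big1 // => i _.
by rewrite (Gx (g i)) // mulr0.
Qed.

(** Each m_j is a scalar times a monomial of degree p on the cone, so passing from y to x multiplies
    the whole list by c^p. At x the components sum to 0, and the triangle inequality bounds each by
    the sum of the others. *)
Lemma vanishing_not_lopsided (f : toric_ring) (x y : 'rV[C]_d) (c : R) (s : seq R) :
  spec k x -> spec k y -> 0 < c ->
  (forall i, Normc.normc (x 0 i) = c * Normc.normc (y 0 i)) ->
  homogeneous f -> toric_eval x f = 0 -> abs_values f y s -> ~ lopsided s.
Proof.
move=> sx sy c0 xy [p [q [qp ->]]] fx [l [m [qm ->]]].
move=> /lopsided_enum [i mi_lt].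
have [w mw] := weight_decomposition_bihomogeneous qp qm.
have scale j : Normc.normc (toric_eval x (m j)) =
    c ^+ p * Normc.normc (toric_eval y (m j)).
  have [a [u [au aE]]] := meval_bihomogeneous (mw j).
  rewrite /toric_eval !aE // !Normc.normcM !normc_prodX mulrCA.
  case: au => [->|<-]; first by rewrite Normc.normc0 !mul0r.
  congr (_ * _); under eq_bigr do rewrite xy exprMn.
  by rewrite big_split /= prodrXr mdegE.
have /eqP : \sum_j toric_eval x (m j) = 0.
  rewrite -[RHS]fx qm.1 -[in RHS](eq_bigr _ (fun j _ => mul1r (m j))).
  rewrite toric_eval_lincomb //; apply: eq_bigr => j _.
  rewrite -[1](rmorph1 (\pi_toric_ring : {rmorphism P -> toric_ring})).
  by rewrite toric_eval_pi // meval1 mul1r.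
rewrite (bigD1 i) //= addr_eq0 => /eqP mi.
move: mi_lt; apply/negP; rewrite -leNgt -(ler_pM2l (exprn_gt0 p c0)) -scale mi.
rewrite mulr_sumr; under [leRHS]eq_bigr do rewrite -scale.
rewrite -[X in X <= _]normcN opprK; exact: normc_sum_le.
Qed.

End NotLopsided.

(** * Image and fibres of the moment map *)

Section MomentMap.
Variables (R : realType) (r d : nat) (k : 'I_d -> 'rV[int]_r).
Local Notation C := R[i].

Lemma sum_normc2_gt0 (x : 'rV[C]_d) : x != 0 ->
  0 < \sum_i Normc.normc (x 0 i) ^+ 2.
Proof.
move=> x0; rewrite lt_neqAle sumr_ge0 ?andbT => [|i _]; last exact: sqr_ge0.
apply: contraNneq x0 => /esym/eqP.
rewrite psumr_eq0 => [/allP s0|i _]; last exact: sqr_ge0.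
apply/eqP/rowP => i; rewrite mxE; apply: Normc.eq0_normc; apply/eqP.
by rewrite -sqrf_eq0; have := s0 i; rewrite mem_index_enum => /(_ isT).
Qed.

(** Both sides of a relation have the same degree, so normalising by S preserves it; moduli and
    squares are multiplicative. *)
Lemma spec_normc_binomials (x : 'rV[C]_d) (a b : 'I_d -> nat) (S : R) :
  spec k x -> (\sum_i a i = \sum_i b i)%N ->
  \sum_i k i *+ a i = \sum_i k i *+ b i ->
  \prod_i (Normc.normc (x 0 i) ^+ 2 / S) ^+ a i =
  \prod_i (Normc.normc (x 0 i) ^+ 2 / S) ^+ b i.
Proof.
move=> /specP sx ab kab.
have mE (c : 'I_d -> nat) i : [multinom c i | i < d] i = c i by rewrite mnmE.
have wE (c : 'I_d -> nat) :
    mnm_weight k [multinom c i | i < d] = \sum_i k i *+ c i.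
  by apply: eq_bigr => i _; rewrite mE.
have dE (c : 'I_d -> nat) : mdeg [multinom c i | i < d] = (\sum_i c i)%N.
  by rewrite mdegE; apply: eq_bigr => i _; rewrite mE.
have xE (c : 'I_d -> nat) : \prod_i (Normc.normc (x 0 i) ^+ 2 / S) ^+ c i =
    Normc.normc (\prod_i x 0 i ^+ [multinom c i | i < d] i) ^+ 2 /
    S ^+ (\sum_i c i).
  rewrite normc_prodX -prodrXl -prodrXr -prodf_div; apply: eq_bigr => i _.
  by rewrite mE expr_div_n exprAC.
by rewrite !xE ab (sx _ [multinom b i | i < d]) // ?dE ?wE.
Qed.

(** The normalised squared moduli of x and of y are barycentric weights of the same point satisfying
    the binomials, hence equal by uniqueness; c is the square root of the ratio of the totals. *)
Lemma moment_map_eq_normc (x y : 'rV[C]_d) :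
  spec k x -> x != 0 -> spec k y -> y != 0 -> moment_map k x = moment_map k y ->
  exists2 c : R, 0 < c &
    forall i, Normc.normc (x 0 i) = c * Normc.normc (y 0 i).
Proof.
move=> sx /sum_normc2_gt0 x0 sy /sum_normc2_gt0 y0 xy.
set Sx := \sum_i _ in x0; set Sy := \sum_i _ in y0.
have pq : (fun i => Normc.normc (x 0 i) ^+ 2 / Sx) =1
    (fun i => Normc.normc (y 0 i) ^+ 2 / Sy).
  apply: (binomial_barycentre_inj (k := k)).
  - by move=> i; rewrite divr_ge0 ?sqr_ge0 // ltW.
  - by move=> i; rewrite divr_ge0 ?sqr_ge0 // ltW.
  - by move=> a b; exact: spec_normc_binomials.
  - by move=> a b; exact: spec_normc_binomials.
  - by rewrite -!mulr_suml !divff ?gt_eqF.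
  - move: xy; rewrite /moment_map !scaler_sumr => xy.
    apply: etrans (etrans _ xy) _; apply: eq_bigr => i _;
      by rewrite scalerA mulrC.
exists (Num.sqrt (Sx / Sy)); first by rewrite sqrtr_gt0 divr_gt0.
move=> i; apply/eqP; rewrite -(eqrXn2 (n := 2)) ?mulr_ge0 ?normc_ge0 ?sqrtr_ge0 //.
rewrite exprMn sqr_sqrtr ?divr_ge0 ?(ltW x0) ?(ltW y0) //.
have /(congr1 ( *%R^~ Sx)) := pq i; rewrite divfK ?(gt_eqF x0) // => ->.
by apply/eqP; ring.
Qed.

Lemma moment_map_mem (Delta : set 'rV[R]_r) (x : 'rV[C]_d) :
  lattice_polytope Delta -> (forall i, Delta (map_mx intr (k i))) -> x != 0 ->
  Delta (moment_map k x).
Proof.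
move=> [n [v ->]] kD /sum_normc2_gt0; set S := \sum_i _ => S0.
have /choice [t tP] := kD.
pose p i := Normc.normc (x 0 i) ^+ 2 / S.
have p0 i : 0 <= p i by rewrite divr_ge0 ?sqr_ge0 // ltW.
exists (fun j => \sum_i p i * t i j); split.
- by move=> j; apply: sumr_ge0 => i _; rewrite mulr_ge0 //; have [] := tP i.
- rewrite exchange_big /=; under eq_bigr => i _.
    rewrite -mulr_sumr; have [_ -> _] := tP i; rewrite mulr1; over.
  by rewrite -mulr_suml divff // gt_eqF.
- rewrite /moment_map scaler_sumr.
  under [RHS]eq_bigr do rewrite scaler_suml.
  rewrite exchange_big /=; apply: eq_bigr => i _.
  have [_ _ ->] := tP i; rewrite scalerA scaler_sumr; apply: eq_bigr => j _.
  by rewrite scalerA /p [S^-1 * _]mulrC.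
Qed.

(** The points spanning Delta are among the k_i, so alpha is a convex combination of the k_i.
    Birch's theorem makes its weights satisfy the binomials, and their square roots are the
    coordinates of a lift. *)
Lemma moment_map_surj (Delta : set 'rV[R]_r) (alpha : 'rV[R]_r) :
  lattice_polytope Delta ->
  (forall z, Delta (map_mx intr z) -> exists i, k i = z) -> Delta alpha ->
  exists x, lift_of k alpha x.
Proof.
move=> [n [v DE]] kD Da.
have /choice [f fP] : forall j, exists i, k i = v j.
  move=> j; apply: kD; rewrite DE.
  exists (fun j' => (j' == j)%:R); split.
  - by move=> j'; rewrite ler0n.
  - by rewrite (bigD1 j) //= eqxx big1 ?addr0 // => j' /negPf ->.
  - rewrite (bigD1 j) //= eqxx scale1r big1 ?addr0 // => j' /negPf ->.
    by rewrite scale0r.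
move: Da; rewrite DE => -[t [t0 t1 aE]].
pose kR i : 'rV[R]_r := map_mx intr (k i).
(* The spanning points may repeat, so the weights of those equal to k_i are added up. *)
have [||p [p0 p1 pk pbin]] :=
  @Analytic.birch R d r kR (fun i => \sum_(j | f j == i) t j).
- by move=> i; rewrite sumr_ge0.
- by rewrite -t1 [RHS](partition_big f xpredT).
pose x : 'rV[C]_d := \row_i (Num.sqrt (p i))%:C%C.
have xE i : Normc.normc (x 0 i) ^+ 2 = p i.
  by rewrite mxE /= expr0n addr0 sqrtr_sqr ger0_norm ?sqrtr_ge0 // sqr_sqrtr.
have Sx : \sum_i Normc.normc (x 0 i) ^+ 2 = 1.
  by under eq_bigr do rewrite xE.
exists x; split.
- apply/specP => a b ab kab.
  suff : \prod_i Num.sqrt (p i) ^+ a i = \prod_i Num.sqrt (p i) ^+ b i.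
    move/(congr1 (real_complex R)); rewrite !rmorph_prod /=.
    under eq_bigr do rewrite rmorphXn /=.
    under [in X in _ = X -> _]eq_bigr do rewrite rmorphXn /=.
    by move=> h; under eq_bigr do rewrite mxE; under [RHS]eq_bigr do rewrite mxE.
  apply/eqP; rewrite -(eqrXn2 (n := 2)) ?prodr_ge0 // => [|i _|i _];
    rewrite ?exprn_ge0 ?sqrtr_ge0 // -!prodrXl; apply/eqP.
  have sq (c : 'I_d -> nat) : \prod_i (Num.sqrt (p i) ^+ c i) ^+ 2 = \prod_i p i ^+ c i.
    by apply: eq_bigr => i _; rewrite exprAC sqr_sqrtr.
  rewrite !sq; apply: pbin; first by rewrite -!mdegE.
  have := congr1 (map_mx (intr : int -> R)) kab; rewrite /mnm_weight !raddf_sum /=.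
  under eq_bigr do rewrite raddfMn.
  by under [in X in _ = X -> _]eq_bigr do rewrite raddfMn.
- apply/eqP => x0; move: Sx; rewrite x0 big1 => [/eqP|i _].
    by rewrite eq_sym oner_eq0.
  by rewrite mxE Normc.normc0 expr0n.
- rewrite /moment_map Sx invr1 scale1r; under eq_bigr do rewrite xE.
  rewrite pk aE [RHS](partition_big f xpredT) //=; apply: eq_bigr => i _.
  by rewrite scaler_suml; apply: eq_bigr => j /eqP <-; rewrite /kR fP.
Qed.

End MomentMap.

(** * Weight components and lopsided differences *)

Section WeightComponents.
Variables (R : realType) (r d : nat) (k : 'I_d -> 'rV[int]_r).
Local Notation C := R[i].
Local Notation P := {mpoly C[d]}.
Local Notation toric_ring := (toric_ring R k).

Definition weight_part (q : P) (w : 'rV[int]_r) : P :=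
  \sum_(u <- msupp q | mnm_weight k u == w) q@_u *: 'X_[u].

Lemma sum_weight_part (q : P) (L : seq 'rV[int]_r) :
  uniq L -> {subset map (mnm_weight k) (msupp q) <= L} ->
  q = \sum_(w <- L) weight_part q w.
Proof.
move=> uL sL; rewrite [LHS]mpolyE (big_undup_fibers _ (mnm_weight k)).
rewrite [RHS](bigID (mem (undup (map (mnm_weight k) (msupp q))))) /=.
rewrite [X in _ = _ + X]big1 => [|w]; last first.
  move=> wq; have {}wq : w \notin map (mnm_weight k) (msupp q).
    by rewrite -mem_undup.
  rewrite /weight_part big_seq_cond big1 // => u /andP[uq /eqP uw].
  by move: wq; rewrite -uw map_f.
rewrite addr0 -[RHS]big_filter; apply: perm_big; apply: uniq_perm.
- exact: undup_uniq.
- exact: filter_uniq.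
move=> w; rewrite mem_filter mem_undup.
by case: (boolP (w \in map _ _)) => [/sL|].
Qed.

Definition torus_translate (lambda : 'I_r -> C) (x : 'rV[C]_d) : 'rV[C]_d :=
  \row_i (torus_char (k i) lambda * x 0 i).

Lemma prod_torus_translate (lambda : 'I_r -> C) (x : 'rV[C]_d) (u : 'X_{1..d}) :
  (forall j, lambda j != 0) ->
  \prod_i torus_translate lambda x 0 i ^+ u i =
  torus_char (mnm_weight k u) lambda * \prod_i x 0 i ^+ u i.
Proof.
move=> l0; rewrite torus_char_mnm // -big_split; apply: eq_bigr => i _.
by rewrite mxE exprMn.
Qed.

Lemma spec_torus_translate (lambda : 'I_r -> C) (x : 'rV[C]_d) :
  (forall j, lambda j != 0) -> spec k x -> spec k (torus_translate lambda x).
Proof.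
move=> l0 /specP sx; apply/specP => u v uv wuv.
by rewrite !prod_torus_translate // wuv (sx u v).
Qed.

(** Along a torus orbit q becomes a Laurent polynomial in lambda whose coefficients are the values
    of its weight components, the form to which [laurent_coeff_le] applies. *)
Lemma meval_torus_translate (lambda : 'I_r -> C) (x : 'rV[C]_d) (q : P)
    (L : seq 'rV[int]_r) :
  (forall j, lambda j != 0) -> uniq L ->
  {subset map (mnm_weight k) (msupp q) <= L} ->
  q.@[torus_translate lambda x 0] =
  \sum_(w <- L) torus_char w lambda * (weight_part q w).@[x 0].
Proof.
move=> l0 uL sL; rewrite {1}(sum_weight_part uL sL) raddf_sum.
apply: eq_bigr => w _ /=; rewrite /weight_part !raddf_sum mulr_sumr.
apply: eq_bigr => u /eqP uw /=.
by rewrite !mevalZ !mevalX prod_torus_translate // uw mulrCA.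
Qed.

Lemma weight_vector_pi w (q : P) :
  (forall lambda : 'I_r -> C, (forall j, lambda j != 0) ->
     torus_subst k lambda q = torus_char w lambda *: q) ->
  weight_vector w (\pi_toric_ring q).
Proof.
move=> qw lambda l0; rewrite torus_act_pi // qw //.
by rewrite -rmorphM /= mul_mpolyC.
Qed.

Lemma torus_subst_weight_part w (q : P) (lambda : 'I_r -> C) :
  (forall j, lambda j != 0) ->
  torus_subst k lambda (weight_part q w) = torus_char w lambda *: weight_part q w.
Proof.
move=> l0; rewrite /weight_part /torus_subst raddf_sum scaler_sumr.
apply: eq_bigr => u /eqP uw /=; rewrite comp_mpolyZ -/(torus_subst _ _ _).
by rewrite torus_substX // uw !scalerA mulrC.
Qed.

(** The component of weight w0 is x^v minus that of E; at y its modulus is at least |y^v| minus that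
    of the component of E, which by assumption still exceeds the sum of all the others. *)
Lemma lopsided_sub_monomial (y : 'rV[C]_d) (v : 'X_{1..d}) (E : P)
    (L : seq 'rV[int]_r) :
  spec k y -> uniq L -> mnm_weight k v \in L ->
  {subset map (mnm_weight k) (msupp E) <= L} ->
  \sum_(w <- L) Normc.normc (weight_part E w).@[y 0] <
    Normc.normc (\prod_i y 0 i ^+ v i) ->
  exists2 s, abs_values (\pi_toric_ring ('X_[v] - E)) y s & lopsided s.
Proof.
move=> sy uL vL EL; set w0 := mnm_weight k v => small.
pose h w : P := (if w == w0 then 'X_[v] else 0) - weight_part E w.
have hw w : weight_vector w (\pi_toric_ring (h w)).
  apply: weight_vector_pi => lambda l0.
  rewrite /h /torus_subst comp_mpolyB -!/(torus_subst _ _ _) scalerBr.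
  rewrite torus_subst_weight_part //; congr (_ - _); case: eqP => [->|_].
    by rewrite torus_substX.
  by rewrite scaler0 /torus_subst comp_mpoly0.
(* A weight decomposition has nonzero terms, so the weights whose component vanishes in the quotient
   are dropped. *)
pose L2 := [seq w <- L | \pi_toric_ring (h w) != 0].
have uL2 : uniq L2 by rewrite filter_uniq.
have hE : \pi_toric_ring ('X_[v] - E) = \sum_(w <- L2) \pi_toric_ring (h w).
  rewrite big_filter; transitivity (\sum_(w <- L) \pi_toric_ring (h w)).
    rewrite -raddf_sum; congr (\pi_toric_ring _); rewrite sumrB.
    rewrite -sum_weight_part //; congr (_ - _).
    rewrite (bigD1_seq w0) //= eqxx big1 ?addr0 // => w /negPf ->.
    by [].
  by rewrite [LHS](bigID (fun w => \pi_toric_ring (h w) != 0)) /=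
    [X in _ + X]big1 ?addr0 // => w /negPn /eqP.
pose g w := Normc.normc (toric_eval y (\pi_toric_ring (h w))).
have gE w : w != w0 -> g w = Normc.normc (weight_part E w).@[y 0].
  move=> ww0; rewrite /g toric_eval_pi // mevalB (negPf ww0) meval0 sub0r.
  exact: normcN.
have g0 : Normc.normc (\prod_i y 0 i ^+ v i) <=
    g w0 + Normc.normc (weight_part E w0).@[y 0].
  rewrite /g toric_eval_pi // mevalB eqxx mevalX.
  rewrite -lecR rmorphD /=.
  by have := ler_normD (\prod_i y 0 i ^+ v i - (weight_part E w0).@[y 0])
    ((weight_part E w0).@[y 0]); rewrite subrK.
have lt_g0 : \sum_(w <- L | w != w0) g w < g w0.
  rewrite (eq_bigr (fun w => Normc.normc (weight_part E w).@[y 0])) //.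
  move: small; rewrite (bigD1_seq w0) //= => small.
  by move: (lt_le_trans small g0); rewrite addrC ltrD2r.
(* The dominant component survives the filter, since its value at y has modulus larger than a
   nonnegative sum. *)
have w0L2 : w0 \in L2.
  rewrite mem_filter vL andbT; apply: contraTneq lt_g0 => hw0.
  rewrite -leNgt /g hw0 -(rmorph0 (\pi_toric_ring : {rmorphism P -> toric_ring})).
  rewrite toric_eval_pi // meval0 Normc.normc0.
  by apply: sumr_ge0 => w _; exact: normc_ge0.
exists [seq g (nth 0 L2 (i : 'I_(size L2))) | i <- enum 'I_(size L2)].
  exists (size L2), (fun i => \pi_toric_ring (h (nth 0 L2 i))); split => //; split.
    by rewrite hE (big_nth 0) big_mkord.
  exists (fun i => nth 0 L2 i); split=> [i j /eqP|i].
    by rewrite nth_uniq // => /eqP /val_inj.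
  split; last exact: hw.
  by have := mem_nth 0 (ltn_ord i); rewrite mem_filter => /andP[].
apply/lopsided_enum.
have i0P : (index w0 L2 < size L2)%N by rewrite index_mem.
exists (Ordinal i0P) => /=; rewrite nth_index //.
apply: le_lt_trans lt_g0.
have -> : \sum_(j < size L2 | j != Ordinal i0P) g (nth 0 L2 j) =
    \sum_(w <- L2 | w != w0) g w.
  rewrite (big_nth 0) big_mkord; apply: eq_bigl => j.
  by rewrite -[in RHS](nth_index 0 w0L2) nth_uniq // -val_eqE.
rewrite big_filter_cond /= [leRHS]big_mkcond [leLHS]big_mkcond.
apply: ler_sum => w _; case: (_ != w0); rewrite ?andbF ?andbT //.
by case: ifP => // _; exact: normc_ge0.
Qed.

Lemma mnm_weight_bound (u : 'X_{1..d}) (j : 'I_r) :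
  (absz (mnm_weight k u 0%R j) <=
    (\sum_i \sum_j absz (k i 0%R j)) * mdeg u)%N.
Proof.
rewrite -lez_nat abszE /mnm_weight summxE; apply: le_trans (ler_norm_sum _ _ _) _.
rewrite mdegE big_distrr /= -[X in _ <= X]natz natr_sum; apply: ler_sum => i _.
rewrite natz mulmxnE normrMn -mulr_natr natz PoszM ler_wpM2r //.
rewrite -abszE lez_nat (bigD1 i) //= (bigD1 j) //= -addnA; exact: leq_addr.
Qed.

End WeightComponents.

(** * Complex conjugation realised by polynomials on a fibre *)

Section ConjugateMultiplier.
Variables (R : realType) (d : nat).
Local Notation C := R[i].
Local Notation P := {mpoly C[d]}.
Variable y : 'rV[C]_d.

(** The exponent is 0 where y vanishes, so that this monomial has no zero on the fibre |x_i| =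
    |y_i|. *)
Definition support_mnm (N : nat) : 'X_{1..d} :=
  [multinom (if y 0%R i == 0%R then 0%N else N) | i < d].

(* On the torus |x_i| = |y_i| the conjugate of a monomial x^u is
   |y|^(2u) x^(-u); multiplying by a high power of the coordinates that do not
   vanish makes this a polynomial. *)
Definition conj_multiplier (e : 'X_{1..d}) (q : P) : P :=
  \sum_(u <- msupp q) ((q@_u)^* * \prod_i `|y 0 i| ^+ (2 * u i)) *: 'X_[e - u].

(** Subtraction of exponents is truncated, so the degree of e - u is the expected one only for u <=
    e. If u involves a coordinate where y vanishes, its coefficient is 0; otherwise its entries are
    at most p <= N. *)
Lemma conj_multiplier_homog (N p : nat) (q : P) : (p <= N)%N ->
  q \is p.-homog ->
  q * conj_multiplier (support_mnm N) q \is (mdeg (support_mnm N)).-homog.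
Proof.
move=> pN qp; rewrite mulr_sumr big_seq; apply: rpred_sum => u uq.
have [/forallP uS|] := boolP [forall i, (y 0 i == 0) ==> (u i == 0%N)]; last first.
  rewrite negb_forall => /existsP [i iP]; move: iP.
  rewrite negb_imply => /andP[/eqP yi ui].
  rewrite (bigD1 i) //= yi normr0 expr0n muln_eq0 (negPf ui) mul0r mulr0.
  by rewrite scale0r mulr0 dhomog0.
have up : mdeg u = p := dhomog_mf qp uq.
have ue : (u <= support_mnm N)%MM.
  apply/mnm_lepP => i; rewrite mnmE; case: ifP => yi.
    by have := uS i; rewrite yi => /eqP ->.
  by apply: leq_trans pN; rewrite -up mdegE (bigD1 i) //= leq_addr.
have -> : mdeg (support_mnm N) = (p + mdeg (support_mnm N - u))%N.
  by rewrite -[in LHS](submK ue) mdegD addnC up.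
by apply: dhomogM => //; apply: dhomogZ; rewrite dhomogX.
Qed.

Lemma meval_conj_multiplier (N p : nat) (q : P) (x : 'rV[C]_d) : (p <= N)%N ->
  q \is p.-homog -> (forall i, `|x 0 i| = `|y 0 i|) ->
  (q * conj_multiplier (support_mnm N) q).@[x 0] =
  `|q.@[x 0]| ^+ 2 * \prod_i x 0 i ^+ support_mnm N i.
Proof.
move=> pN qp xy; rewrite mevalM normCK -mulrA; congr (_ * _).
rewrite raddf_sum /= [in RHS]mevalE rmorph_sum mulr_suml.
rewrite big_seq [RHS]big_seq; apply: eq_bigr => u uq.
have up : mdeg u = p := dhomog_mf qp uq.
rewrite mevalZ mevalX rmorphM rmorph_prod -!mulrA -!big_split /=; congr (_ * _).
apply: eq_bigr => i _; rewrite mnmBE mnmE rmorphXn /= exprM -xy normCK.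
(* Where y_i = 0 also x_i = 0, and both sides reduce to [0 ^+ u i], which is 1 for [u i = 0]. *)
case: ifP => [yi|_].
  have -> : x 0 i = 0 by apply/eqP; rewrite -normr_eq0 xy normr_eq0.
  by rewrite sub0n expr0 mulr1 mul0r rmorph0 mulr1.
have uN : (u i <= N)%N.
  by apply: leq_trans pN; rewrite -up mdegE (bigD1 i) //= leq_addr.
by rewrite exprMn -[in RHS](subnK uN) exprD; ring.
Qed.

Lemma meval_bound (q : P) : exists B : R, forall x : 'rV[C]_d,
  (forall i, `|x 0 i| = `|y 0 i|) -> Normc.normc q.@[x 0] ^+ 2 <= B.
Proof.
exists ((\sum_(u <- msupp q) Normc.normc (q@_u * \prod_i y 0 i ^+ u i)) ^+ 2).
move=> x xy; rewrite lerXn2r ?nnegrE ?normc_ge0 //.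
  by apply: sumr_ge0 => u _; exact: normc_ge0.
rewrite mevalE; apply: le_trans (normc_sum_le _ _ _) _.
apply: ler_sum => u _; rewrite !Normc.normcM !normc_prodX.
by under eq_bigr do rewrite (complexI (xy _)).
Qed.

End ConjugateMultiplier.

(** * Construction of a lopsided element of the ideal *)

Section LopsidedWitness.
Variables (R : realType) (r d : nat) (k : 'I_d -> 'rV[int]_r).
Local Notation C := R[i].
Local Notation P := {mpoly C[d]}.
Local Notation toric_ring := (toric_ring R k).

Lemma ccontinuous_meval (q : P) :
  Analytic.ccontinuous (fun x : 'rV[C]_d => q.@[x 0]).
Proof.
rewrite (_ : (fun _ => _) = (fun x : 'rV[C]_d =>
  \sum_(u <- msupp q) q@_u * \prod_i x 0 i ^+ u i)); last first.
  by apply/funext => x; rewrite mevalE.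
apply: Analytic.ccontinuous_sum => u; apply: Analytic.ccontinuousM.
  exact: Analytic.ccontinuous_cst.
apply: Analytic.ccontinuous_prod => i; apply: Analytic.ccontinuousX.
exact: Analytic.ccontinuous_coord.
Qed.

Lemma ideal_gen_mull (S : comNzRingType) (G : set S) (a g : S) :
  ideal_gen G g -> ideal_gen G (a * g).
Proof.
move=> [n [b [h [hG ->]]]]; exists n, (fun i => a * b i), h; split=> //.
by rewrite mulr_sumr; apply: eq_bigr => i _; rewrite mulrA.
Qed.

Lemma ideal_gen_sub (S : comNzRingType) (G : set S) : G `<=` ideal_gen G.
Proof.
move=> g gG; exists 1%N, (fun=> 1), (fun=> g); split=> //.
by rewrite big_ord1 mul1r.
Qed.

Lemma ideal_gen_sum (S : comNzRingType) (G : set S) (n : nat) (g : 'I_n -> S) :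
  (forall i, ideal_gen G (g i)) -> ideal_gen G (\sum_i g i).
Proof.
move=> gG; elim/big_ind: _ => [|a b [n1 [a1 [g1 [g1G ->]]]] [n2 [a2 [g2 [g2G ->]]]]|//].
  by exists 0%N, (fun=> 0), (fun=> 0); split=> [[]//|]; rewrite big_ord0.
exists (n1 + n2)%N, (fun i => match split i with inl j => a1 j | inr j => a2 j end),
  (fun i => match split i with inl j => g1 j | inr j => g2 j end).
split=> [i|]; first by case: split.
by rewrite big_split_ord /=; congr (_ + _); apply: eq_bigr => i _;
  rewrite ?(unsplitK (inl i)) ?(unsplitK (inr i)).
Qed.

(** If all homogeneous polynomials representing generators vanished at a point x of the fibre, x
    would be a common zero of the ideal. Taking the toric ideal as the family of constraints keeps
    the compact fibre inside the cone. *)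
Lemma fiber_generators (G : set toric_ring) (y : 'rV[C]_d) :
  G `<=` @homogeneous R r d k -> spec k y -> y != 0 ->
  (forall x, proj_lifts (ideal_gen G) x ->
     ~ forall i, Normc.normc (x 0 i) = Normc.normc (y 0 i)) ->
  exists (s : seq P) (delta : R), [/\ 0 < delta,
    forall q, q \in s -> G (\pi_toric_ring q) /\ exists p, q \is p.-homog
    & forall x, spec k x -> (forall i, Normc.normc (x 0 i) = Normc.normc (y 0 i)) ->
      delta <= \sum_(q <- s) Normc.normc q.@[x 0] ^+ 2].
Proof.
move=> Ghom sy y0 Gy.
pose D := [set q : P | G (\pi_toric_ring q) /\ exists p, q \is p.-homog].
have [|||s [delta [d0 sD sdelta]]] := @Analytic.polytorus_sum_sqr_lower_bound R d
    {q : P | q \in toric_ideal k} (fun q x => (sval q).@[x 0])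
    (fun i => Normc.normc (y 0 i)) P D (fun q x => q.@[x 0]).
- by move=> q; exact: ccontinuous_meval.
- by move=> q; exact: ccontinuous_meval.
- move=> x [Kx xy]; have sx : spec k x by move=> q qJ; exact: (Kx (exist _ q qJ)).
  have x0 : x != 0.
    apply: contraNneq y0 => x0; apply/eqP/rowP => i; rewrite mxE.
    by apply: Normc.eq0_normc; rewrite -xy x0 mxE Normc.normc0.
  apply: contrapT => noq; apply: (Gy x) => //; split=> //.
  apply: vanishing_ideal_gen => // g gG; have [p [q [qp gE]]] := Ghom _ gG.
  rewrite gE toric_eval_pi //.
  have [//|qx] := eqVneq q.@[x 0] 0.
  by case: noq; exists q => //; split; [rewrite -gE | exists p].
exists s, delta; split=> // x sx xy; apply: sdelta; split=> // -[q qJ]; exact: sx.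
Qed.

Lemma lopsided_witness (G : set toric_ring) (y : 'rV[C]_d) :
  G `<=` @homogeneous R r d k -> spec k y -> y != 0 ->
  (forall x, proj_lifts (ideal_gen G) x ->
     ~ forall i, Normc.normc (x 0 i) = Normc.normc (y 0 i)) ->
  exists f s, [/\ ideal_gen G f, homogeneous f, abs_values f y s & lopsided s].
Proof.
move=> Ghom sy y0 Gy.
have [s [delta [delta0 sG sdelta]]] := fiber_generators Ghom sy y0 Gy.
pose K x := spec k x /\ forall i, Normc.normc (x 0 i) = Normc.normc (y 0 i).
(* A nonzero q has degree below [msize q]; the zero polynomial, homogeneous of every degree, is
   assigned degree 0. *)
have [N sN] : exists N, forall q, q \in s -> exists2 p, (p <= N)%N & q \is p.-homog.
  exists (\sum_(q <- s) msize q)%N => q qs; have [_ [p qp]] := sG q qs.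
  have [->|q0] := eqVneq q 0; first by exists 0%N; rewrite ?dhomog0.
  exists p => //; rewrite (big_rem q) //=; apply: leq_trans (leq_addr _ _).
  have [u uq] : exists u, u \in msupp q.
    by exists (mlead q); exact: mlead_supp.
  have up : mdeg u = p := dhomog_mf qp uq.
  by rewrite -up ltnW // msize_mdeg_lt.
pose e := support_mnm y N.
pose F : P := \sum_(q <- s) q * conj_multiplier y e q.
pose GG (x : 'rV[C]_d) := \sum_(q <- s) Normc.normc q.@[x 0] ^+ 2.
have normK (x : 'rV[C]_d) : (forall i, Normc.normc (x 0 i) = Normc.normc (y 0 i)) ->
    forall i, `|x 0 i| = `|y 0 i|.
  by move=> xy i; rewrite -[LHS]/((Normc.normc _)%:C%C) xy.
have FE x : K x -> F.@[x 0] = (GG x)%:C%C * \prod_i x 0 i ^+ e i.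
  move=> [sx /normK xy]; rewrite raddf_sum rmorph_sum mulr_suml /=.
  rewrite big_seq [RHS]big_seq; apply: eq_bigr => q /sN [p pN qp].
  by rewrite (meval_conj_multiplier pN) // rmorphXn.
have Fhom : F \is (mdeg e).-homog.
  rewrite /F big_seq; apply: rpred_sum => q /sN [p pN qp].
  exact: conj_multiplier_homog qp.
have FI : ideal_gen G (\pi_toric_ring F).
  rewrite /F raddf_sum (big_nth 0) big_mkord; apply: ideal_gen_sum => i /=.
  rewrite rmorphM mulrC; apply: ideal_gen_mull; apply: ideal_gen_sub.
  exact: (sG _ (mem_nth 0 (ltn_ord i))).1.
have [M0 M0P] : exists M : R, forall x, K x -> GG x <= M.
  have bounds (t : seq P) : exists B : R, forall x, K x ->
      \sum_(q <- t) Normc.normc q.@[x 0] ^+ 2 <= B.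
    elim: t => [|q t [B BP]]; first by exists 0 => x _; rewrite big_nil.
    have [B' B'P] := meval_bound y q; exists (B' + B) => x Kx.
    by rewrite big_cons lerD ?BP // B'P //; exact: normK Kx.2.
  exact: bounds.
have Ky : K y by [].
(* Adding delta to a nonnegative upper bound keeps it an upper bound and makes it positive. *)
pose M := delta + Num.max M0 0.
have M_gt0 : 0 < M by rewrite ltr_pwDl // le_max lexx orbT.
have GM x : K x -> GG x <= M.
  move=> /M0P /le_trans; apply.
  by rewrite /M ler_wpDl ?(ltW delta0) // le_max lexx.
have dG x : K x -> delta <= GG x by case=> sx xy; exact: sdelta.
pose theta := 1 - delta / M.
have theta01 : 0 <= theta < 1.
  rewrite subr_ge0 ler_pdivrMr // mul1r (le_trans (dG y Ky) (GM y Ky)) /=.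
  by rewrite ltrBlDr ltrDl divr_gt0.
pose sigma := Normc.normc (\prod_i y 0 i ^+ e i).
have sigma0 : 0 < sigma.
  rewrite lt_neqAle normc_ge0 andbT eq_sym; apply/eqP => /Normc.eq0_normc /eqP.
  apply/negP/prodf_neq0 => i _; rewrite mnmE; case: ifP => [_|yi].
    by rewrite expr0 oner_eq0.
  by rewrite expf_neq0 // yi.
(* On the fibre T equals x^e (1 - G/M), and delta <= G <= M places the last factor between 0 and
   theta. *)
pose T : P := 'X_[e] - (M^-1)%:C%C *: F.
have TK x : K x -> Normc.normc T.@[x 0] <= sigma * theta.
  move=> Kx; rewrite mevalB mevalX mevalZ FE // mulrA -{1}[\prod_i _]mul1r -mulrBl.
  rewrite Normc.normcM mulrC normc_prodX.
  under eq_bigr do rewrite Kx.2.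
  rewrite -normc_prodX -/sigma ler_pM2l //.
  have -> : 1 - (M^-1)%:C%C * (GG x)%:C%C = (1 - GG x / M)%:C%C.
    by rewrite rmorphB rmorph1 -rmorphM mulrC.
  rewrite /= expr0n addr0 sqrtr_sqr ger0_norm.
    by rewrite lerB // ler_pM2r ?invr_gt0 // dG.
  by rewrite subr_ge0 ler_pdivrMr // mul1r GM.
pose kappa := (\sum_i \sum_j absz (k i 0%R j))%N.
(* The constant is chosen so that (2 kappa deg(e) n + 1)^r bounds the number of weights of degree n
   deg(e). *)
have [n nP] := poly_times_geometric_lt1 r (2 * (kappa * mdeg e)) theta01.
pose E := T ^+ n.
have Thom : T \is (mdeg e).-homog.
  by rewrite rpredB // ?dhomogX //; apply: dhomogZ.
have Ehom : E \is (mdeg e * n).-homog by exact: dhomogMn.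
pose v := (e *+ n)%MM.
(* The weight of v is added explicitly, since it may be absent from the support of E. *)
pose L := undup (mnm_weight k v :: map (mnm_weight k) (msupp E)).
have uL : uniq L := undup_uniq _.
have EL : {subset map (mnm_weight k) (msupp E) <= L}.
  by move=> w wE; rewrite mem_undup inE wE orbT.
have sizeL : (size L <= (2 * (kappa * (mdeg e * n))).+1 ^ r)%N.
  apply: size_bounded_weights => // w; rewrite mem_undup inE => /orP [/eqP ->|wE] j.
    by apply: leq_trans (mnm_weight_bound _ _ _) _; rewrite mdegMn.
  case/mapP: wE => u uE ->; apply: leq_trans (mnm_weight_bound _ _ _) _.
  by have -> : mdeg u = (mdeg e * n)%N := dhomog_mf Ehom uE.
(* Translating y by unit lambda stays in the fibre, so the bound on T there, raised to the power n,
   bounds E uniformly in lambda; the coefficients in lambda inherit it. *)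
have partE : {in L, forall w, `|(weight_part k E w).@[y 0]| <=
    ((sigma * theta) ^+ n)%:C%C}.
  apply: laurent_coeff_le => // lambda l1.
  have l0 j : lambda j != 0 by rewrite -normr_eq0 l1 oner_eq0.
  rewrite -(meval_torus_translate _ l0 uL EL).
  have Kl : K (torus_translate k lambda y).
    split=> [|i]; first exact: spec_torus_translate.
    suff : `|torus_translate k lambda y 0 i| = `|y 0 i| by exact: complexI.
    rewrite mxE normrM /torus_char normr_prod big1 ?mul1r // => j _.
    by case: (k i 0 j) => m; rewrite /exprz ?normfV normrX l1 expr1n ?invr1.
  rewrite /E rmorphXn normrX rmorphXn lerXn2r ?nnegrE //.
    by rewrite lecR mulr_ge0 ?(ltW sigma0) //; case/andP: theta01.
  by rewrite -[X in X <= _]/((Normc.normc _)%:C%C) lecR TK.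
have vL : mnm_weight k v \in L by rewrite mem_undup inE eqxx.
have small : \sum_(w <- L) Normc.normc (weight_part k E w).@[y 0] <
    Normc.normc (\prod_i y 0 i ^+ v i).
  have -> : Normc.normc (\prod_i y 0 i ^+ v i) = sigma ^+ n.
    rewrite /sigma !normc_prodX -prodrXl; apply: eq_bigr => i _.
    by rewrite mulmnE exprM.
  apply: (@le_lt_trans _ _ (\sum_(w <- L) (sigma * theta) ^+ n)).
    rewrite big_seq [leRHS]big_seq; apply: ler_sum => w /partE.
    by rewrite -[X in X <= _]/((Normc.normc _)%:C%C) lecR.
  rewrite big_const_seq count_predT iter_addr_0 -mulr_natr exprMn -mulrA.
  rewrite gtr_pMr ?exprn_gt0 //; apply: le_lt_trans nP.
  rewrite mulrC ler_wpM2r ?exprn_ge0 //; first by case/andP: theta01.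
  by rewrite -natrX ler_nat; move: sizeL; rewrite !mulnA.
have [sv sabs slop] := lopsided_sub_monomial sy uL vL EL small.
exists (\pi_toric_ring ('X_[v] - E)), sv; split=> //.
  (* x^(ne) - T^n is divisible by x^e - T = F/M, which lies in the ideal. *)
  rewrite /v -mpolyXn /E subrXX rmorphM mulrC; apply: ideal_gen_mull.
  have -> : 'X_[e] - T = (M^-1)%:C%C%:MP * F.
    by rewrite mul_mpolyC /T opprB addrCA subrr addr0.
  by rewrite rmorphM; apply: ideal_gen_mull.
exists (mdeg e * n)%N, ('X_[v] - E); split=> //.
apply: rpredB => //; rewrite dhomogX; apply/eqP; exact: mdegMn.
Qed.

End LopsidedWitness.

(** * The amoeba as an intersection and through lopsidedness *)

Theorem corollary5p6 (R : realType) (r d : nat)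
    (Delta : set 'rV[R]_r) (Delta_polytope : lattice_polytope Delta)
    (k : 'I_d -> 'rV[int]_r) (k_inj : injective k)
    (k_A : forall z : 'rV[int]_r, (exists i, k i = z) <-> Delta (map_mx intr z))
    (I : set (toric_ring R k)) (I_homog : homogeneous_ideal I) :
  amoeba I = \bigcap_(f in I `&` @homogeneous R r d k) amoeba (ideal_gen [set f])
  /\
  (* tilde chooses a lift of every alpha that has one, hence of every alpha in
     Delta, since mu(X) = Delta *)
  (forall tilde : 'rV[R]_r -> 'rV[R[i]]_d,
     (forall alpha, (exists x, lift_of k alpha x) ->
        lift_of k alpha (tilde alpha)) ->
     amoeba I =
       [set alpha | Delta alpha /\
          forall f, I f -> homogeneous f ->
          forall s, abs_values f (tilde alpha) s -> ~ lopsided s]).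
Proof.
have [G Ghom ->] := I_homog.
have not_lopsided (f : toric_ring R k) (x y : 'rV[R[i]]_d) s :
    spec k x -> x != 0 -> spec k y -> y != 0 ->
    moment_map k x = moment_map k y -> homogeneous f -> toric_eval x f = 0 ->
    abs_values f y s -> ~ lopsided s.
  move=> sx x0 sy y0 xy fhom fx ys.
  have [c c0 cxy] := moment_map_eq_normc sx x0 sy y0 xy.
  by have := vanishing_not_lopsided sx sy c0 cxy fhom fx ys.
(* The moment map depends only on moduli, so a common zero on the fibre of y would put alpha in the
   amoeba. *)
have witness alpha y : lift_of k alpha y -> ~ amoeba (ideal_gen G) alpha ->
    exists f s, [/\ ideal_gen G f, homogeneous f, abs_values f y s & lopsided s].
  move=> [sy y0 ya] nGa; apply: lopsided_witness => // x Gx xy; apply: nGa.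
  exists x => //; rewrite -ya /moment_map; under eq_bigr do rewrite xy.
  by congr (_ *: _); apply: eq_bigr => i _; rewrite xy.
split.
  apply/seteqP; split=> [_ [x [sx x0 Gx] <-] f [Gf fhom]|alpha Ha].
    exists x => //; split=> //; apply: vanishing_ideal_gen => // g ->.
    exact: Gx.
  apply: contrapT => nGa.
  (* The element f = 0 belongs to the intersection, and its amoeba supplies a lift y of alpha. *)
  have [y [sy y0 _] ya] : amoeba (ideal_gen [set (0 : toric_ring R k)]) alpha.
    apply: Ha; split.
      by exists 0%N, (fun=> 0), (fun=> 0); split=> [[]//|]; rewrite big_ord0.
    by exists 0%N, 0; split; [exact: dhomog0 | rewrite rmorph0].
  have [f [s [Gf fhom fs slop]]] := witness alpha y (And3 sy y0 ya) nGa.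
  (* Since alpha lies in the amoeba of this f too, f has a zero over alpha, which contradicts its
     lopsided list at y. *)
  have [x [sx x0 fx] xa] := Ha f (conj Gf fhom).
  apply: not_lopsided sx x0 sy y0 _ fhom (fx f _) fs slop.
    by rewrite xa ya.
  exact: ideal_gen_sub.
move=> tilde tildeP; apply/seteqP; split=> [_ [x [sx x0 Gx] <-]|alpha [Da Ha]].
  have [|sy y0 ya] := tildeP (moment_map k x); first by exists x.
  split=> [|f Gf fhom s fs].
    by apply: moment_map_mem => // i; apply/k_A; exists i.
  exact: not_lopsided sx x0 sy y0 (esym ya) fhom (Gx f Gf) fs.
apply: contrapT => nGa.
have lift : lift_of k alpha (tilde alpha).
  apply: tildeP; apply: moment_map_surj Da => // z; exact: (k_A z).2.
have [f [s [Gf fhom fs slop]]] := witness _ _ lift nGa.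
exact: Ha Gf fhom s fs slop.
Qed.
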